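(* Let $D$ be a squarefree integer. Then there is a non-trivial arithmetic progression of three cubes over $\mathbb{Q}(\sqrt{D})$ if and only if the elliptic curve $F^D: y^2=x^3+D^3$ (the $D$-quadratic twist of the modular curve $X_0(36)$) has positive rank over $\mathbb{Q}$.
   Context: The modular curve $X_0(36)$ is the elliptic curve with Weierstrass model $y^2=x^3+1$; its $D$-quadratic twist is $y^2=x^3+D^3$. An arithmetic progression of three cubes over a field $k$ is a triple $x_0^3,x_1^3,x_2^3$ with $x_0,x_1,x_2\in k$ not all zero and $x_1^3-x_0^3=x_2^3-x_1^3$. It is trivial if it is constant ($x_0^3=x_1^3=x_2^3$) or proportional to the progression $-1,0,1$ (i.e. $x_1=0$); otherwise it is non-trivial. *)

(* Defs.v *)
From HB Require Import structures.
From mathcomp Require Import all_boot all_order all_algebra all_field.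
From mathcomp Require Import ring.
From mathcomp Require Import boolp constructive_ereal.

Set Implicit Arguments.
Unset Strict Implicit.
Unset Printing Implicit Defensive.

Import GRing.Theory Num.Theory.
Local Open Scope ring_scope.

Section RawLaw.
Variables (K : fieldType) (a b : K).

(* Points of y^2 = x^3 + a x + b; None is the point at infinity. *)
Definition on_curve (P : option (K * K)) : bool :=
  if P is Some (x, y) then y ^+ 2 == x ^+ 3 + a * x + b else true.

Definition raw_opp (P : option (K * K)) : option (K * K) :=
  if P is Some (x, y) then Some (x, - y) else None.

(* The reflection in the x-axis of the third intersection point of the curve
   with the line of slope l through (x1, y1) and a point of abscissa x2. *)
Definition line_sum (l x1 y1 x2 : K) : option (K * K) :=
  let x3 := l ^+ 2 - x1 - x2 in Some (x3, l * (x1 - x3) - y1).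

Definition raw_add (P Q : option (K * K)) : option (K * K) :=
  match P, Q with
  | None, _ => Q
  | _, None => P
  | Some (x1, y1), Some (x2, y2) =>
      if x1 != x2 then line_sum ((y2 - y1) / (x2 - x1)) x1 y1 x2
      else if y1 == - y2 then None
      else line_sum ((3 * x1 ^+ 2 + a) / (2 * y1)) x1 y1 x2
  end.

Hypothesis disc_neq0 : -16 * (4 * a ^+ 3 + 27 * b ^+ 2) != 0.

Lemma two_neq0 : (2 : K) != 0.
Proof.
apply: contraNneq disc_neq0 => h.
have -> : (16 : K) = 2 * 8 by ring.
by rewrite h mul0r oppr0 mul0r.
Qed.

Definition chord (l : K) (A B : K * K) : Prop :=
  l * (A.1 - B.1) = A.2 - B.2 /\
  l * (A.2 + B.2) = A.1 ^+ 2 + A.1 * B.1 + B.1 ^+ 2 + a.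

Definition opposite (A B : K * K) : bool := (A.1 == B.1) && (A.2 == - B.2).

Lemma raw_add_opp A B : opposite A B -> raw_add (Some A) (Some B) = None.
Proof. by case: A B => [x y] [u v] /andP[/= /eqP-> ->]; rewrite eqxx. Qed.

Lemma same_x x y v : on_curve (Some (x, y)) -> on_curve (Some (x, v)) ->
  y != - v -> y = v.
Proof.
move=> /eqP hy /eqP hv ne; apply/eqP; rewrite -subr_eq0.
have : (y - v) * (y + v) = 0.
  have -> : (y - v) * (y + v) = y ^+ 2 - v ^+ 2 by ring.
  by rewrite hy hv subrr.
move/eqP; rewrite mulf_eq0 => /orP[//|]; by rewrite [y + v == 0]addr_eq0 (negPf ne).
Qed.

Lemma dbl_neq0 (y : K) : y != - y -> y != 0.
Proof. by apply: contraNneq => ->; rewrite oppr0. Qed.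

Lemma raw_addP A B : on_curve (Some A) -> on_curve (Some B) -> ~~ opposite A B ->
  exists2 l, chord l A B &
    raw_add (Some A) (Some B) = line_sum l A.1 A.2 B.1.
Proof.
case: A B => [x1 y1] [x2 y2] hA hB; rewrite /opposite /=.
case: eqVneq => [e|ne] /=; last first.
  move=> _; exists ((y2 - y1) / (x2 - x1)) => //.
  have ne' : x2 - x1 != 0 by rewrite subr_eq0 eq_sym.
  move: hA hB => /eqP hA /eqP hB; split=> /=.
    by field.
  have -> : (y2 - y1) / (x2 - x1) * (y1 + y2) = (y2 ^+ 2 - y1 ^+ 2) / (x2 - x1).
    by field.
  by rewrite hA hB; field.
subst x2 => ne; rewrite (negPf ne).
have e : y1 = y2 by apply: same_x hA hB ne.
subst y2; have y0 := dbl_neq0 ne; have h2 := two_neq0.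
exists ((3 * x1 ^+ 2 + a) / (2 * y1)) => //.
split=> /=; first by rewrite !subrr mulr0.
by field; rewrite y0.
Qed.

Lemma chord_uniq l m A B : ~~ opposite A B -> chord l A B -> chord m A B -> l = m.
Proof.
move=> nop [l1 l2] [m1 m2]; apply/eqP; rewrite -subr_eq0.
have h1 : (l - m) * (A.1 - B.1) = 0 by rewrite mulrBl l1 m1 subrr.
have h2 : (l - m) * (A.2 + B.2) = 0 by rewrite mulrBl l2 m2 subrr.
move/eqP: h1; rewrite mulf_eq0 => /orP[//|]; rewrite [A.1 - _ == 0]subr_eq0 => e1.
move/eqP: h2; rewrite mulf_eq0 => /orP[//|]; rewrite [A.2 + _ == 0]addr_eq0 => e2.
by move: nop; rewrite /opposite e1 e2.
Qed.

Lemma raw_addE l A B : on_curve (Some A) -> on_curve (Some B) -> ~~ opposite A B ->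
  chord l A B -> raw_add (Some A) (Some B) = line_sum l A.1 A.2 B.1.
Proof.
move=> hA hB nop hl; have [m hm ->] := raw_addP hA hB nop.
by rewrite (chord_uniq nop hl hm).
Qed.

Lemma chordC l A B : chord l A B -> chord l B A.
Proof.
move=> [h1 h2]; split; last by rewrite [B.2 + _]addrC h2; ring.
have e : l * (B.1 - A.1) = - (l * (A.1 - B.1)) by ring.
by rewrite e h1 opprB.
Qed.

Lemma oppositeC A B : opposite A B = opposite B A.
Proof.
by rewrite /opposite eq_sym; congr (_ && _); rewrite -eqr_oppLR eq_sym.
Qed.

Lemma on_curve_line l A B : on_curve (Some A) -> chord l A B ->
  on_curve (line_sum l A.1 A.2 B.1).
Proof.
case: A B => [x1 y1] [x2 y2] /= /eqP hA [/= h1 h2]; apply/eqP.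
have hb : b = y1 ^+ 2 - x1 ^+ 3 - a * x1 by rewrite hA; ring.
have e : y2 = y1 - l * (x1 - x2) by rewrite h1; ring.
have ha : a = l * (y1 + y2) - (x1 ^+ 2 + x1 * x2 + x2 ^+ 2) by rewrite h2; ring.
by rewrite hb ha e; ring.
Qed.

Lemma on_curve_opp P : on_curve P -> on_curve (raw_opp P).
Proof. by case: P => [[x y]|] //=; rewrite sqrrN. Qed.

Lemma on_curve_add P Q : on_curve P -> on_curve Q -> on_curve (raw_add P Q).
Proof.
case: P Q => [A|] [B|] hA hB //; last by case: A hA.
case: (boolP (opposite A B)) => [/raw_add_opp->//|nop].
have [l hl ->] := raw_addP hA hB nop; exact: on_curve_line.
Qed.

Lemma raw_add0 P : raw_add P None = P. Proof. by case: P => [[]|]. Qed.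

Lemma raw_oppK P : raw_opp (raw_opp P) = P.
Proof. by case: P => [[x y]|] //=; rewrite opprK. Qed.

Lemma raw_addN P : raw_add (raw_opp P) P = None.
Proof. by case: P => [[x y]|] //=; rewrite !eqxx. Qed.

Lemma raw_addC P Q : on_curve P -> on_curve Q -> raw_add P Q = raw_add Q P.
Proof.
case: P Q => [A|] [B|] hA hB //; rewrite ?raw_add0 //.
case: (boolP (opposite A B)) => nop.
  by rewrite !raw_add_opp // oppositeC.
have [l hl ->] := raw_addP hA hB nop.
rewrite (raw_addE hB hA _ (chordC hl)) 1?oppositeC //.
case: hl => h1 _; rewrite /line_sum; congr (Some (_, _)); first by ring.
have -> : A.2 = B.2 + l * (A.1 - B.1) by rewrite h1; ring.
by ring.
Qed.

Lemma raw_oppD P Q : on_curve P -> on_curve Q ->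
  raw_opp (raw_add P Q) = raw_add (raw_opp P) (raw_opp Q).
Proof.
case: P Q => [[x1 y1]|] [[x2 y2]|] hA hB //.
have nopE : opposite (x1, - y1) (x2, - y2) = opposite (x1, y1) (x2, y2).
  by rewrite /opposite /= eqr_opp.
case: (boolP (opposite (x1, y1) (x2, y2))) => nop.
  by rewrite /raw_opp !raw_add_opp ?nopE.
have [l [h1 h2] ->] := raw_addP hA hB nop.
rewrite /raw_opp (@raw_addE (- l) (x1, - y1) (x2, - y2)) ?nopE //.
- by rewrite /line_sum /= sqrrN; congr (Some (_, _)); ring.
- by have := on_curve_opp hA.
- by have := on_curve_opp hB.
- split=> /=; first by rewrite mulNr h1 /=; ring.
  by rewrite -opprD mulrNN h2.
Qed.

Lemma line_sum_neq l A B : on_curve (Some A) -> on_curve (Some B) ->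
  chord l A B -> line_sum l A.1 A.2 B.1 <> Some A.
Proof.
case: A B => [x1 y1] [x2 y2] /eqP hA /eqP hB [/= h1 h2] [ex ey].
have h2K := two_neq0.
have el : l ^+ 2 = 2 * x1 + x2.
  have e : l ^+ 2 = (l ^+ 2 - x1 - x2) + x1 + x2 by ring.
  by rewrite e ex; ring.
have y0 : y1 = 0.
  move: ey; rewrite ex subrr mulr0 sub0r => e.
  apply/eqP; rewrite -[_ == _]orFb -(negPf h2K) -mulf_eq0.
  by rewrite mulr_natl mulr2n -{1}e addNr.
have e2 : y2 = - l * (x1 - x2) by rewrite mulNr h1 y0; ring.
have ha : a = - 3 * x1 ^+ 2.
  have -> : a = l * (y1 + y2) - (x1 ^+ 2 + x1 * x2 + x2 ^+ 2) by rewrite h2; ring.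
  rewrite y0 e2.
  have -> : l * (0 + - l * (x1 - x2)) = - l ^+ 2 * (x1 - x2) by ring.
  by rewrite el; ring.
have hb : b = 2 * x1 ^+ 3.
  have -> : b = y1 ^+ 2 - x1 ^+ 3 - a * x1 by rewrite hA; ring.
  by rewrite y0 ha; ring.
by move: disc_neq0; rewrite ha hb; case/eqP; ring.
Qed.

Lemma raw_addKr P Q : on_curve P -> on_curve Q ->
  raw_add (raw_opp P) (raw_add P Q) = Q.
Proof.
case: P Q => [[x1 y1]|] [[x2 y2]|] hA hB //; last first.
  by rewrite raw_add0 raw_addN.
case: (boolP (opposite (x1, y1) (x2, y2))) => nop.
  rewrite raw_add_opp // raw_add0 /=.
  by case/andP: nop => /= /eqP-> /eqP->; rewrite opprK.
have [l hl eP] := raw_addP hA hB nop.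
have hP := on_curve_line hA hl; have neP := line_sum_neq hA hB hl.
have [h1 h2] := hl; rewrite /= in h1 h2.
pose X := l ^+ 2 - x1 - x2; pose Y := l * (x1 - X) - y1.
have eS : line_sum l x1 y1 x2 = Some (X, Y) by [].
rewrite eP /raw_opp; move: hP neP; rewrite [_.1]/= [_.2]/= [(x2, y2).1]/= eS => hP neP.
have ey : y2 = y1 - l * (x1 - x2) by rewrite h1; ring.
have ea : a = l * (y1 + y2) - (x1 ^+ 2 + x1 * x2 + x2 ^+ 2) by rewrite h2; ring.
rewrite (@raw_addE (- l) (x1, - y1) (X, Y)) //.
- by rewrite /line_sum sqrrN ey /X /=; congr (Some (_, _)); ring.
- by have := on_curve_opp hA.
- apply/negP => /andP[/= /eqP eX /eqP eY]; apply: neP.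
  by rewrite -eX -[Y]opprK -eY opprK.
- by split=> /=; rewrite ?ea ?ey /Y /X; ring.
Qed.

Lemma line_sumC l A B : chord l A B ->
  line_sum l A.1 A.2 B.1 = line_sum l B.1 B.2 A.1.
Proof.
case: A B => [x1 y1] [x2 y2] [/= h1 _]; rewrite /line_sum.
have -> : y1 = y2 + l * (x1 - x2) by rewrite h1; ring.
by congr (Some (_, _)); ring.
Qed.

Definition third (l : K) (A B : K * K) : K * K :=
  (l ^+ 2 - A.1 - B.1, l * (A.1 - (l ^+ 2 - A.1 - B.1)) - A.2).

Lemma third_x_eq l A B C : on_curve (Some A) -> on_curve (Some C) ->
  chord l A B -> ~~ opposite (third l A B) C -> (third l A B).1 = C.1 ->
  C = third l A B.
Proof.
move=> hA hC hl nop e.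
have hP : on_curve (Some (third l A B)) by have := on_curve_line hA hl.
case: C hC nop e => [x3 y3] hC; move: hP; case: (third l A B) => [X Y] hP.
rewrite /opposite /= => nop e; move: nop hP; rewrite e eqxx /= => ne hP.
by rewrite (same_x hP hC ne).
Qed.

Lemma assoc_gen l m s t A B C :
  chord l A B -> chord m B C -> l != m ->
  (third l A B).1 != C.1 -> (third m B C).1 != A.1 ->
  chord s (third l A B) C -> chord t A (third m B C) ->
  third s (third l A B) C = third t A (third m B C).
Proof.
case: A B C => [x1 y1] [x2 y2] [x3 y3] [/= h1 h2] [/= h3 h4] nlm nP nQ [/= hs _] [/= ht _].
have h2K := two_neq0; rewrite /third /=.
have ey1 : y1 = y2 + l * (x1 - x2) by rewrite h1; ring.
have ey3 : y3 = y2 - m * (x2 - x3) by rewrite h3; ring.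
have nlm0 : m - l != 0 by rewrite subr_eq0 eq_sym.
have ey2 : y2 = ((x3 - x1) * (x1 + x2 + x3) + l ^+ 2 * (x1 - x2)
                 - m ^+ 2 * (x3 - x2)) / (2 * (m - l)).
  have E : y2 * (2 * (m - l)) = (x3 - x1) * (x1 + x2 + x3) + l ^+ 2 * (x1 - x2)
                 - m ^+ 2 * (x3 - x2).
    have e1 : m * (y2 + y3) - l * (y1 + y2) = (x3 - x1) * (x1 + x2 + x3).
      by rewrite h2 h4; ring.
    by rewrite -e1 ey1 ey3; ring.
  by rewrite -E mulfK // mulf_neq0.
have nP' : l ^+ 2 - x1 - x2 - x3 != 0 by rewrite subr_eq0.
have nQ' : x1 - (m ^+ 2 - x2 - x3) != 0 by rewrite subr_eq0 eq_sym.
have es : s = (l * (x1 - (l ^+ 2 - x1 - x2)) - y1 - y3) / (l ^+ 2 - x1 - x2 - x3).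
  by rewrite -hs mulfK.
have et : t = (y1 - (m * (x2 - (m ^+ 2 - x2 - x3)) - y2)) / (x1 - (m ^+ 2 - x2 - x3)).
  by rewrite -ht mulfK.
rewrite es et ey1 ey3 ey2.
congr (_, _); field; rewrite ?h2K ?nlm0 ?nP' ?nQ'.
all: by [].
Qed.


Lemma assoc_dbl l m s t A B C : C = third l A B ->
  chord l A B -> chord m B C -> C.1 != B.1 -> C.2 != 0 ->
  (third m B C).1 != A.1 ->
  chord s C C -> chord t A (third m B C) ->
  third s C C = third t A (third m B C).
Proof.
case: A B C => [x1 y1] [x2 y2] [x3 y3] [e3 e3'] [/= h1 h2] [/= h3 h4] nC nC2 nQ.
move=> [/= _ hs] [/= ht _]; have h2K := two_neq0; rewrite /third /=.
have ey1 : y1 = y2 + l * (x1 - x2) by rewrite h1; ring.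
have ea : a = l * (y1 + y2) - (x1 ^+ 2 + x1 * x2 + x2 ^+ 2) by rewrite h2; ring.
have nC' : x2 - x3 != 0 by rewrite subr_eq0 eq_sym.
have nQ' : x1 - (m ^+ 2 - x2 - x3) != 0 by rewrite subr_eq0 eq_sym.
have nC2' : y3 + y3 != 0 by rewrite -mulr2n -mulr_natl mulf_neq0.
have em : m = (y2 - y3) / (x2 - x3) by rewrite -h3 mulfK.
have es : s = (x3 ^+ 2 + x3 * x3 + x3 ^+ 2 + a) / (y3 + y3) by rewrite -hs mulfK.
have et : t = (y1 - (m * (x2 - (m ^+ 2 - x2 - x3)) - y2)) / (x1 - (m ^+ 2 - x2 - x3)).
  by rewrite -ht mulfK.
have nQ2 : (x2 - x3) ^+ 2 * (x1 - (m ^+ 2 - x2 - x3)) != 0 by rewrite mulf_neq0 ?expf_neq0.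
have nQ2' : x1 * (x2 - x3) ^+ 2 - ((y2 - y3) ^+ 2 + - x2 * (x2 - x3) ^+ 2
    + - x3 * (x2 - x3) ^+ 2) != 0.
  suff <- : (x2 - x3) ^+ 2 * (x1 - (m ^+ 2 - x2 - x3)) =
     x1 * (x2 - x3) ^+ 2 - ((y2 - y3) ^+ 2 + - x2 * (x2 - x3) ^+ 2
    + - x3 * (x2 - x3) ^+ 2) by [].
  by rewrite em; field.
rewrite es et em; move: nC' nC2' nQ2'; rewrite ea e3' e3 ey1 => nC' nC2' nQ2'.
by congr (_, _); field; rewrite nC' nC2' nQ2'.
Qed.

Lemma assoc_two l s t A B C : chord l A B -> C = third l A B -> B.2 = 0 ->
  A.2 != 0 -> C.2 != 0 -> chord s C C -> chord t A A ->
  third s C C = third t A A.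
Proof.
case: A B C => [x1 y1] [x2 y2] [x3 y3] [/= h1 h2] [e3 e3'] /= e2 n1 n3 [/= _ hs] [/= _ ht].
have h2K := two_neq0; rewrite /third /=.
subst y2.
have ey1 : y1 = l * (x1 - x2) by rewrite h1; ring.
have ea : a = l * y1 - (x1 ^+ 2 + x1 * x2 + x2 ^+ 2) by rewrite -[y1]addr0 h2; ring.
have n1' : y1 + y1 != 0 by rewrite -mulr2n -mulr_natl mulf_neq0.
have n3' : y3 + y3 != 0 by rewrite -mulr2n -mulr_natl mulf_neq0.
have es : s = (x3 ^+ 2 + x3 * x3 + x3 ^+ 2 + a) / (y3 + y3) by rewrite -hs mulfK.
have et : t = (x1 ^+ 2 + x1 * x1 + x1 ^+ 2 + a) / (y1 + y1) by rewrite -ht mulfK.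
move: n1' n3'; rewrite es et ea e3' e3 ey1 => n1' n3'.
by congr (_, _); field; rewrite n1' n3'.
Qed.

Lemma opposite_opp A B : opposite A B -> Some A = raw_opp (Some B).
Proof. by case: A B => [x y] [u v] /andP[/= /eqP-> /eqP->]. Qed.

Lemma opposite_self A : ~~ opposite A A -> A.2 != 0.
Proof. by rewrite /opposite eqxx /=; apply: contraNneq => ->; rewrite oppr0. Qed.

Lemma raw_addA_self A B C Q :
  on_curve (Some A) -> on_curve (Some B) -> on_curve (Some C) ->
  ~~ opposite A B -> ~~ opposite B C -> ~~ opposite C C -> ~~ opposite A Q ->
  raw_add (Some A) (Some B) = Some C -> raw_add (Some B) (Some C) = Some Q ->
  raw_add (Some A) (Some Q) = raw_add (Some C) (Some C).
Proof.
move=> hA hB hC nAB nBC nCC nAQ eAB eBC.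
have hQ : on_curve (Some Q) by rewrite -eBC on_curve_add.
have [l hl el] := raw_addP hA hB nAB; have [m hm em] := raw_addP hB hC nBC.
have [s hs es] := raw_addP hC hC nCC; have [t ht et] := raw_addP hA hQ nAQ.
have eC : C = third l A B by move: el; rewrite eAB => -[->].
have eQ : Q = third m B C by move: em; rewrite eBC => -[->].
rewrite es et -/(third _ _ _) -[line_sum s _ _ _]/(Some (third s C C)).
rewrite -[line_sum t _ _ _]/(Some (third t A Q)); congr Some; apply/esym.
have C0 := opposite_self nCC.
have [exQ|nxQ] := eqVneq Q.1 A.1; last first.
  rewrite eQ; rewrite eQ in ht nxQ.
  apply: (assoc_dbl eC hl hm _ C0 nxQ hs ht).
  apply/negP => /eqP ex; apply: (line_sum_neq hB hA (chordC hl)).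
  rewrite -(line_sumC hl) -el eAB.
  move: hB hC nBC ex; case: (B) (C) => [x2 y2] [x3 y3] hB' hC'.
  rewrite /opposite /= => + ex; move: hC'; rewrite ex eqxx /= => hC' ne.
  by rewrite (same_x hB' hC' ne).
have eQA : Q = A.
  move: hQ hA nAQ exQ; case: (Q) (A) => [x2 y2] [x3 y3] hQ' hA'.
  rewrite /opposite /= => + ex; move: hQ'; rewrite ex eqxx /= => hQ' ne.
  by rewrite (same_x hA' hQ' ne).
rewrite eQA in ht nAQ eBC *.
apply: (assoc_two hl eC _ (opposite_self nAQ) C0 hs ht).
have e1 := raw_addKr hA hB; rewrite eAB in e1.
have e2 := raw_addKr hC hB; rewrite (raw_addC hC hB) eBC in e2.
have e3 : raw_opp (Some B) = Some B.
  by rewrite -{1}e1 raw_oppD ?on_curve_opp // raw_oppK raw_addC ?on_curve_opp.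
move: e3; case: (B) => [x y] [/= e]; apply/eqP.
by rewrite -[_ == _]orFb -(negPf two_neq0) -mulf_eq0 mulr_natl mulr2n -{1}e addNr.
Qed.

Lemma raw_addA P Q R : on_curve P -> on_curve Q -> on_curve R ->
  raw_add P (raw_add Q R) = raw_add (raw_add P Q) R.
Proof.
case: P Q R => [A|] [B|] [C|] hA hB hC; rewrite ?raw_add0 //.
have [oAB|nAB] := boolP (opposite A B).
  rewrite (raw_add_opp oAB) (opposite_opp oAB) raw_addKr //.
have [oBC|nBC] := boolP (opposite B C).
  rewrite (raw_add_opp oBC) raw_add0.
  move: oBC; rewrite oppositeC => /opposite_opp->.
  rewrite raw_addC ?on_curve_opp ?on_curve_add //.
  by rewrite (raw_addC hA hB) raw_addKr.
have [l hl el] := raw_addP hA hB nAB; have [m hm em] := raw_addP hB hC nBC.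
have hP := on_curve_add hA hB; have hQ := on_curve_add hB hC.
case eP : (raw_add (Some A) (Some B)) hP => [P|] hP; last by rewrite eP in el.
case eQ : (raw_add (Some B) (Some C)) hQ => [Q|] hQ; last by rewrite eQ in em.
have [oPC|nPC] := boolP (opposite P C).
  rewrite (raw_add_opp oPC) -eQ.
  move: oPC; rewrite oppositeC => /opposite_opp->.
  rewrite -eP raw_oppD // [raw_add (raw_opp _) _]raw_addC ?on_curve_opp //.
  rewrite -{1}[Some B]raw_oppK raw_addKr ?on_curve_opp //.
  by rewrite raw_addC ?on_curve_opp // raw_addN.
have [oAQ|nAQ] := boolP (opposite A Q).
  rewrite (raw_add_opp oAQ) -eP (raw_addC hA hB) (opposite_opp oAQ) -eQ.
  rewrite raw_oppD // -{1}[Some B]raw_oppK raw_addKr ?on_curve_opp //.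
  by rewrite raw_addN.
have [s hs es] := raw_addP hP hC nPC; have [t ht et] := raw_addP hA hQ nAQ.
have dP : P = third l A B by move: el; rewrite eP => -[->].
have dQ : Q = third m B C by move: em; rewrite eQ => -[->].
have [exP|nxP] := eqVneq P.1 C.1.
  have eC : C = P.
    rewrite dP; apply: third_x_eq hA hC hl _ _; by rewrite -dP.
  rewrite -eC in nPC eP; rewrite -eC.
  exact: (@raw_addA_self A B C Q).
have [exQ|nxQ] := eqVneq Q.1 A.1.
  have eA : A = Q.
    rewrite dQ; apply: third_x_eq hB hA hm _ _; by rewrite -dQ // oppositeC.
  rewrite -eA in nAQ eQ; rewrite -eA.
  apply/esym; rewrite (raw_addC hP hC).
  apply: (@raw_addA_self C B A P) => //; rewrite 1?oppositeC //; by rewrite raw_addC.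
have [elm|nlm] := eqVneq l m.
  have [exAC|nxAC] := eqVneq A.1 C.1.
    have eAC : A = C.
      move: hl hm exAC; rewrite elm; case: (A) (C) => [x1 y1] [x3 y3] [/= h1 _] [/= h2 _] ex.
      congr (_, _) => //.
      have -> : y1 = B.2 + m * (x1 - B.1) by rewrite h1; ring.
      have -> : y3 = B.2 - m * (B.1 - x3) by rewrite h2; ring.
      by rewrite ex; ring.
    have ePQ : P = Q.
      by move: eP; rewrite raw_addC // eAC eQ => -[].
    by rewrite ePQ -eAC raw_addC.
  case/negP: nxP; rewrite dP /third /= subr_eq subr_eq; apply/eqP.
  apply: (@mulIf _ (C.1 - A.1)); first by rewrite subr_eq0 eq_sym.
  move: hl hm; rewrite -elm => -[h1 h2] [h3 h4].
  have -> : l ^+ 2 * (C.1 - A.1) = - l * (l * (A.1 - B.1) + l * (B.1 - C.1)) by ring.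
  rewrite h1 h3.
  have -> : - l * (A.2 - B.2 + (B.2 - C.2)) = l * (B.2 + C.2) - l * (A.2 + B.2) by ring.
  by rewrite h2 h4; ring.
rewrite et es -[line_sum s _ _ _]/(Some (third s P C)).
rewrite -[line_sum t _ _ _]/(Some (third t A Q)); congr Some; apply/esym.
rewrite dP dQ; rewrite dP in nxP hs; rewrite dQ in nxQ ht.
exact: assoc_gen hl hm nlm nxP nxQ hs ht.
Qed.
End RawLaw.

Record ellCurve (K : fieldType) := EllCurve {
  ec_a : K;
  ec_b : K;
  ec_disc : -16 * (4 * ec_a ^+ 3 + 27 * ec_b ^+ 2) != 0
}.

Record ec_point (K : fieldType) (E : ellCurve K) := ECPoint {
  ec_val : option (K * K);
  ec_valP : on_curve (ec_a E) (ec_b E) ec_val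
}.

Section Group.
Variables (K : fieldType) (E : ellCurve K).

HB.instance Definition _ := [isSub for @ec_val K E].
HB.instance Definition _ := [Choice of ec_point E by <:].

Definition ec_zero : ec_point E :=
  @ECPoint K E None isT.
Definition ec_opp (P : ec_point E) : ec_point E :=
  ECPoint (on_curve_opp (ec_valP P)).
Definition ec_add (P Q : ec_point E) : ec_point E :=
  ECPoint (on_curve_add (ec_disc E) (ec_valP P) (ec_valP Q)).

Fact ec_addA : associative ec_add.
Proof.
by move=> P Q R; apply/val_inj/(raw_addA (ec_disc E)); apply: ec_valP.
Qed.
Fact ec_addC : commutative ec_add.
Proof.
by move=> P Q; apply/val_inj/(raw_addC (ec_disc E)); apply: ec_valP.
Qed.
Fact ec_add0 : left_id ec_zero ec_add.
Proof. by move=> P; apply: val_inj. Qed.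
Fact ec_addN : left_inverse ec_zero ec_opp ec_add.
Proof. by move=> P; apply: val_inj; apply: raw_addN. Qed.

HB.instance Definition _ :=
  GRing.isZmodule.Build (ec_point E) ec_addA ec_addC ec_add0 ec_addN.
End Group.

Definition Zindependent (G : zmodType) (n : nat) (P : 'I_n -> G) : Prop :=
  forall c : 'I_n -> int, \sum_i P i *~ c i = 0 -> forall i, c i = 0.

Definition max_independent (G : zmodType) (r : nat) : Prop :=
  (exists P : 'I_r -> G, Zindependent P) /\
  (forall n (P : 'I_n -> G), Zindependent P -> (n <= r)%N).

(* The rank of an abelian group, i.e. the dimension of its tensor product with
   the rationals: the largest size of a Z-linearly independent family, or
   +oo if these sizes are unbounded. *)
Definition abelian_rank (G : zmodType) : \bar int :=
  if pselect (exists r, max_independent G r) is left h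
  then (Posz (projT1 (cid h)))%:E else +oo%E.

Definition squarefree (D : int) : Prop :=
  forall d : int, (d ^+ 2 %| D)%Z -> d \is a GRing.unit.

Lemma squarefree_neq0 (D : int) : squarefree D -> D != 0.
Proof.
move=> sqD; apply/eqP => D0; have := sqD 0.
by rewrite D0 dvdz0 unitr0 => /(_ isT).
Qed.

Fact twist36_disc (D : int) : squarefree D ->
  -16 * (4 * 0 ^+ 3 + 27 * (D%:Q ^+ 3) ^+ 2) != 0.
Proof.
move=> /squarefree_neq0 D0; rewrite expr0n mulr0 add0r.
apply: mulf_neq0; first by rewrite oppr_eq0 pnatr_eq0.
apply: mulf_neq0; first by rewrite pnatr_eq0.
by apply: expf_neq0; apply: expf_neq0; rewrite intr_eq0.
Qed.

(* The curve y^2 = x^3 + D^3. *)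
Definition twist36 (D : int) (sqD : squarefree D) : ellCurve rat :=
  @EllCurve rat 0 (D%:Q ^+ 3) (twist36_disc sqD).

(* The subfield Q(sqrt D) of the field of algebraic numbers. *)
Definition in_Qsqrt (D : int) : {pred algC} :=
  fun z => `[< exists p q : rat, z = ratr p + ratr q * sqrtC D%:~R >].

Fact in_Qsqrt_closed (D : int) : divring_closed (in_Qsqrt D).
Proof.
have s2 : sqrtC D%:~R * sqrtC D%:~R = ratr D%:~R :> algC.
  by rewrite -expr2 sqrtCK ratr_int.
have M z w : z \in in_Qsqrt D -> w \in in_Qsqrt D -> z * w \in in_Qsqrt D.
  move=> /asboolP[p [q ->]] /asboolP[u [v ->]]; apply/asboolP.
  exists (p * u + q * v * D%:~R), (p * v + q * u).
  rewrite !(rmorphD, rmorphM) /= -s2; ring.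
split.
- by apply/asboolP; exists 1, 0; rewrite rmorph1 rmorph0 mul0r addr0.
- move=> z w /asboolP[p [q ->]] /asboolP[u [v ->]]; apply/asboolP.
  by exists (p - u), (q - v); rewrite !rmorphB /=; ring.
move=> z w zD wD; apply: M => //.
have [->|w0] := eqVneq w 0; first by rewrite invr0; apply/asboolP; exists 0, 0; rewrite rmorph0; ring.
case/asboolP: wD w0 => [p [q ->]]; set s := sqrtC _ => w0.
have [N0|N0] := eqVneq (p ^+ 2 - q ^+ 2 * D%:~R) 0.
  have : (ratr p + ratr q * s) * (ratr p - ratr q * s) = 0.
    have -> : (ratr p + ratr q * s) * (ratr p - ratr q * s)
       = ratr p ^+ 2 - ratr q ^+ 2 * (s * s) by ring.
    by rewrite s2 -!rmorphXn -rmorphM -rmorphB /= N0 rmorph0.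
  move/eqP; rewrite mulf_eq0 (negPf w0) /= subr_eq0 => /eqP <-.
  apply/asboolP; exists (p + p)^-1, 0.
  by rewrite rmorph0 mul0r addr0 fmorphV rmorphD.
apply/asboolP; exists (p / (p ^+ 2 - q ^+ 2 * D%:~R)), (- q / (p ^+ 2 - q ^+ 2 * D%:~R)).
have N0' : ratr p ^+ 2 - ratr q ^+ 2 * (s * s) != 0 :> algC.
  by rewrite s2 -!rmorphXn -rmorphM -rmorphB fmorph_eq0.
have -> : ratr (p / (p ^+ 2 - q ^+ 2 * D%:~R)) = ratr p / (ratr p ^+ 2 - ratr q ^+ 2 * (s * s)) :> algC.
  by rewrite s2 -!rmorphXn -rmorphM -rmorphB /= fmorph_div.
have -> : ratr (- q / (p ^+ 2 - q ^+ 2 * D%:~R)) = - ratr q / (ratr p ^+ 2 - ratr q ^+ 2 * (s * s)) :> algC.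
  by rewrite s2 -!rmorphXn -rmorphM -rmorphB /= fmorph_div rmorphN.
move: (ratr p : algC) (ratr q : algC) w0 N0' => P Q w0 N0'.
by rewrite -/s; field; rewrite w0 N0'.
Qed.

HB.instance Definition _ (D : int) :=
  GRing.isDivringClosed.Build algC (in_Qsqrt D) (in_Qsqrt_closed D).

Record Qsqrt (D : int) := InQsqrt {
  Qsqrt_val :> algC;
  Qsqrt_valP : Qsqrt_val \in in_Qsqrt D
}.

HB.instance Definition _ (D : int) := [isSub for @Qsqrt_val D].
HB.instance Definition _ (D : int) := [Choice of Qsqrt D by <:].
HB.instance Definition _ (D : int) := [SubChoice_isSubIntegralDomain of Qsqrt D by <:].
HB.instance Definition _ (D : int) := [SubIntegralDomain_isSubField of Qsqrt D by <:].

Definition cubes_AP (k : fieldType) (x0 x1 x2 : k) : Prop :=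
  ~ [/\ x0 = 0, x1 = 0 & x2 = 0] /\
  x1 ^+ 3 - x0 ^+ 3 = x2 ^+ 3 - x1 ^+ 3.

Definition trivial_cubes_AP (k : fieldType) (x0 x1 x2 : k) : Prop :=
  (x0 ^+ 3 = x1 ^+ 3 /\ x1 ^+ 3 = x2 ^+ 3) \/ x1 = 0.

Definition has_nontrivial_cubes_AP (k : fieldType) : Prop :=
  exists x0 x1 x2 : k, cubes_AP x0 x1 x2 /\ ~ trivial_cubes_AP x0 x1 x2.

(* Main.v *)
Require Import Defs.
From mathcomp Require Import all_boot all_order all_algebra all_field.
From mathcomp Require Import boolp constructive_ereal.
From mathcomp Require Import zify ring lra cyclic.

(* Put [t = x / D], so that the rational points of [F^D] are the rational
   solutions of [D s^2 = t^3 + 1] and doubling acts on [t] by a map independent of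
   [D]. This map strictly decreases the 2-adic valuation of [t] when it is at most 0
   and strictly increases it otherwise, unless [t] is -1, 0 or 2; hence a finite
   point is torsion iff [t] is one of these.

   An arithmetic progression [x0^3, x1^3, x2^3] is sent by a 3-isogeny to the point
   [t = - x0 x2 / x1^2], [s = (x2^3 - x0^3) / (2 x1^3)] of [s^2 = t^3 + 1], and the
   dual isogeny goes back. For a point [P] of this curve over Q(sqrt D) with
   conjugate [P'], [P - P'] is a rational point of [F^D] and [P + P'] a rational
   point of the curve itself, hence torsion by an infinite descent. If [P - P']
   were torsion as well, so would be [P], and explicit equations for its coordinates
   leave only points that come from trivial progressions or from a cube root of 2,
   which does not lie in a quadratic field. *)

Set Implicit Arguments.
Unset Strict Implicit.
Unset Printing Implicit Defensive.

Import Order.TTheory GRing.Theory Num.Theory.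

(** * Infinite descent on [s^2 = t^3 + 1] *)

(** The root of [a] is [gcdn a c]. Dividing it out of [a] and [c] leaves coprime [a'] and [c'] with
    [a' b = d^k c'^(k+1)], and Gauss's lemma in both directions gives [a' = d^k]. *)
Lemma coprime_mul_exp k a b c : (0 < a)%N -> coprime a b -> (a * b = c ^ k.+1)%N ->
  exists2 d, (a = d ^ k.+1)%N & exists2 e, (b = e ^ k.+1)%N & (c = d * e)%N.
Proof.
move=> a0 cab eab; set d := gcdn a c.
have d0 : (0 < d)%N by rewrite gcdn_gt0 a0.
have [a' ea] := dvdnP (dvdn_gcdl a c); have [c' ec] := dvdnP (dvdn_gcdr a c).
rewrite -/d in ea ec.
have cac : coprime a' c'.
  by rewrite /coprime -(eqn_pmul2r d0) mul1n muln_gcdl -ea -ec.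
have e1 : (a' * b = d ^ k * c' ^ k.+1)%N.
  apply/eqP; rewrite -(eqn_pmul2l d0) !mulnA -expnS [(d * a')%N]mulnC -ea eab.
  by rewrite {1}ec expnMn mulnC.
have e2 : (a' = d ^ k)%N.
  apply/eqP; rewrite eqn_dvd; apply/andP; split.
    by rewrite -(@Gauss_dvdl a' _ (c' ^ k.+1)) ?coprimeXr // -e1 dvdn_mulr.
  rewrite -(@Gauss_dvdl _ _ b); first by rewrite e1 dvdn_mulr.
  by apply: coprimeXl; apply: coprime_dvdl cab; apply: dvdn_gcdl.
exists d; first by rewrite {1}ea e2 expnSr.
exists c'; last by rewrite mulnC.
apply/eqP; rewrite -(eqn_pmul2l (_ : 0 < d ^ k)%N) ?expn_gt0 ?d0 //.
by rewrite -e1 e2.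
Qed.

Lemma coprime_of_primes a b : (0 < a)%N ->
  (forall p, prime p -> (p %| a)%N -> (p %| b)%N -> False) -> coprime a b.
Proof.
move=> a0 H; rewrite /coprime eqn_leq gcdn_gt0 a0 andbT leqNgt; apply/negP => g.
have pp := pdiv_prime g; apply: (H _ pp).
  by apply: dvdn_trans (pdiv_dvd _) (dvdn_gcdl _ _).
by apply: dvdn_trans (pdiv_dvd _) (dvdn_gcdr _ _).
Qed.

Lemma coprime_primeF p a b : prime p -> coprime a b ->
  (p %| a)%N -> (p %| b)%N -> False.
Proof.
move=> pp cab pa pb; have : (p %| gcdn a b)%N by rewrite dvdn_gcd pa.
by rewrite (eqP cab) dvdn1 => /eqP p1; rewrite p1 in pp.
Qed.

(** The square in the hypothesis serves [p = 3], where the coefficient absorbs one factor. *)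
Lemma prime_dvd_3quartic p g : prime p -> (p ^ 2 %| 3 * g ^ 4)%N -> (p %| g)%N.
Proof.
move=> pp h.
have [e3|n3] := eqVneq p 3%N; last first.
  have : (p %| 3 * g ^ 4)%N by apply: dvdn_trans h; apply: dvdn_exp.
  by rewrite Euclid_dvdM // dvdn_prime2 // (negPf n3) /= Euclid_dvdX // => /andP[].
move: h; rewrite e3 (_ : 3 ^ 2 = 3 * 3)%N // dvdn_pmul2l // Euclid_dvdX //.
by case/andP.
Qed.

Lemma coprime_mul_3quartic P Q g : (0 < P)%N -> (0 < Q)%N -> coprime P Q ->
  (P * Q = 3 * g ^ 4)%N ->
  exists A B, g = (A * B)%N /\
   (P = (A ^ 4)%N /\ Q = (3 * B ^ 4)%N \/ P = (3 * B ^ 4)%N /\ Q = (A ^ 4)%N).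
Proof.
wlog h : P Q / (3 %| P)%N.
  move=> W P0 Q0 cPQ e.
  have : (3 %| P * Q)%N by rewrite e dvdn_mulr.
  rewrite Euclid_dvdM // => /orP[h|h]; first exact: W.
  have [||||A [B [eg H]]] := W Q P h => //; first by rewrite coprime_sym.
    by rewrite mulnC.
  by exists A, B; split=> //; case: H => -[-> ->]; [right|left].
move=> P0 Q0 cPQ; case/dvdnP: h P0 cPQ => P' -> P0 cPQ e.
have cPQ' : coprime P' Q by move: cPQ; rewrite coprimeMl => /andP[].
have [|//||B eB [A eA eg]] := @coprime_mul_exp 3 P' Q g; [by lia| |].
  by apply/eqP; rewrite -(@eqn_pmul2l 3) // -e; apply/eqP; ring.
by exists A, B; split; [rewrite eg mulnC|right; rewrite eB eA mulnC].
Qed.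

(** The equation is [n^2 = (m^2 - 6 g^2)^2 + 12 g^4], with negative terms moved across to stay in
    the naturals. [P] and [Q] are half of [n] minus and plus [m^2 - 6 g^2]; they are coprime with
    product [3 g^4], so one is a fourth power and the other three times one. *)
Lemma quartic_descent1 n m g : (0 < g)%N -> coprime m g ->
  (n ^ 2 + 12 * m ^ 2 * g ^ 2 = m ^ 4 + 48 * g ^ 4)%N ->
  exists A B, [/\ coprime A B, g = (A * B)%N &
    (m ^ 2 + 3 * B ^ 4 = A ^ 4 + 6 * A ^ 2 * B ^ 2)%N].
Proof.
move=> g0 cmg e.
have [P [Q [ePQ sPQ dPQ P0 Q0]]] : exists P Q, [/\ (P * Q = 3 * g ^ 4)%N, (P + Q = n)%N,
   (Q + 6 * g ^ 2 = P + m ^ 2)%N, (0 < P)%N & (0 < Q)%N].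
  have hm : (m ^ 2 < n + 6 * g ^ 2)%N by nia.
  have hn : (6 * g ^ 2 < n + m ^ 2)%N by nia.
  have hp : ~~ odd (n + m ^ 2).
    have : odd (n ^ 2 + 12 * m ^ 2 * g ^ 2) = odd (m ^ 4 + 48 * g ^ 4) by rewrite e.
    rewrite !oddD !oddM ?oddX /=.
    by case: (odd n) (odd m) (odd g) => [] [] [].
  have e1 := odd_double_half (n + m ^ 2); rewrite (negPf hp) add0n -muln2 in e1.
  exists (n - ((n + m ^ 2)./2 - 3 * g ^ 2))%N, ((n + m ^ 2)./2 - 3 * g ^ 2)%N.
  set h := (_./2) in e1 *; split; nia.
have cPQ : coprime P Q.
  apply: coprime_of_primes => // p pp pP pQ.
  have pg : (p %| g)%N by apply: prime_dvd_3quartic => //; rewrite -ePQ -mulnn dvdn_mul.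
  apply: (coprime_primeF pp cmg) => //.
  have : (p %| P + m ^ 2)%N by rewrite -dPQ dvdn_add // dvdn_mull // dvdn_exp.
  by rewrite dvdn_addr // Euclid_dvdX // andbT.
have [A [B [eg [[eP eQ]|[eP eQ]]]]] := coprime_mul_3quartic P0 Q0 cPQ ePQ.
  (* This distribution fails modulo 3: two squares with sum 0 are both 0, so 3 would divide both [P]
     and [Q]. *)
  have : (3 %| A ^ 4 + m ^ 2)%N.
    by rewrite -eP -dPQ eQ dvdn_add ?dvdn_mulr.
  rewrite /dvdn -modnDm -modnXm -[(m ^ 2 %% 3)%N]modnXm => h3.
  have h : (3 %| A)%N.
    rewrite /dvdn; move: h3 (ltn_pmod A (isT : 0 < 3)%N) (ltn_pmod m (isT : 0 < 3)%N).
    by move: (A %% 3)%N (m %% 3)%N => [|[|[|?]]] [|[|[|?]]] //; vm_compute.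
  case: (@coprime_primeF 3 P Q) => //; first by rewrite eP Euclid_dvdX // h.
  by rewrite eQ dvdn_mulr.
exists A, B; split=> //.
  move: cPQ; rewrite eP eQ coprimeMl => /andP[_].
  by rewrite coprime_pexpl // coprime_pexpr // coprime_sym.
rewrite eP eQ eg in dPQ; rewrite addnC -dPQ; ring.
Qed.

(** Here [(A^2 + 3 B^2)^2 = m^2 + 12 B^4], and [P], [Q] are the halves of [A^2 + 3 B^2 - m] and
    [A^2 + 3 B^2 + m]. Their sum returns the equation of [quartic_trivial], now for [C] and [F]. *)
Lemma quartic_descent2 m A B : (0 < B)%N -> coprime A B ->
  (m ^ 2 + 3 * B ^ 4 = A ^ 4 + 6 * A ^ 2 * B ^ 2)%N ->
  exists C F, [/\ coprime C F, B = (C * F)%N &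
    (A ^ 2 + 3 * C ^ 2 * F ^ 2 = C ^ 4 + 3 * F ^ 4)%N].
Proof.
move=> B0 cAB e.
have [P [Q [ePQ sPQ P0 Q0]]] : exists P Q, [/\ (P * Q = 3 * B ^ 4)%N,
   (P + Q = A ^ 2 + 3 * B ^ 2)%N, (0 < P)%N & (0 < Q)%N].
  have eS : ((A ^ 2 + 3 * B ^ 2) ^ 2 = m ^ 2 + 12 * B ^ 4)%N.
    have -> : ((A ^ 2 + 3 * B ^ 2) ^ 2 = A ^ 4 + 6 * A ^ 2 * B ^ 2 + 9 * B ^ 4)%N by ring.
    by rewrite -e; ring.
  have hm : (m < A ^ 2 + 3 * B ^ 2)%N.
    by rewrite -ltn_sqr eS -[X in (X < _)%N]addn0 ltn_add2l muln_gt0 expn_gt0 B0.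
  have hp : ~~ odd (A ^ 2 + 3 * B ^ 2 - m).
    have := congr1 odd eS; rewrite oddB 1?ltnW // oddD !oddX oddM /= addbF => ->.
    by rewrite addbb.
  have := odd_double_half (A ^ 2 + 3 * B ^ 2 - m); rewrite (negPf hp) add0n -muln2.
  move: (_./2) => k ek.
  have eS' : (A ^ 2 + 3 * B ^ 2 = 2 * k + m)%N by lia.
  by exists k, (k + m)%N; rewrite eS' in eS *; split; lia.
have cPQ : coprime P Q.
  apply: coprime_of_primes => // p pp pP pQ.
  have pB : (p %| B)%N by apply: prime_dvd_3quartic => //; rewrite -ePQ -mulnn dvdn_mul.
  apply: (coprime_primeF pp cAB) => //.
  have : (p %| A ^ 2 + 3 * B ^ 2)%N by rewrite -sPQ dvdn_add.
  by rewrite dvdn_addl ?Euclid_dvdX ?andbT // dvdn_mull // dvdn_exp.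
have [C [F [eB H]]] := coprime_mul_3quartic P0 Q0 cPQ ePQ.
exists C, F; split=> //; last first.
  have e2 : (A ^ 2 + 3 * C ^ 2 * F ^ 2 = P + Q)%N by rewrite sPQ eB; ring.
  by rewrite e2; case: H => -[-> ->]; ring.
move: cPQ; case: H => -[-> ->].
  by rewrite coprimeMr => /andP[_]; rewrite coprime_pexpl // coprime_pexpr.
rewrite coprimeMl => /andP[_]; rewrite coprime_pexpl // coprime_pexpr //.
by rewrite coprime_sym.
Qed.

(* For odd [e] the equation is first multiplied by 16, so that both parities
   of [e] become the equation of [quartic_descent1] with second unknown [2 g]. *)
Lemma quartic_trivial N M e : (0 < e)%N -> coprime M e ->
  (N ^ 2 + 3 * M ^ 2 * e ^ 2 = M ^ 4 + 3 * e ^ 4)%N -> M = 1%N /\ e = 1%N.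
Proof.
have [k] := ubnP e; elim: k N M e => // k IH N M e /ltnSE le_ek e0 cMe E.
have [n [m [g [g0 cmg e1 ge H]]]] : exists n m g,
    [/\ (0 < g)%N, coprime m g, (n ^ 2 + 12 * m ^ 2 * g ^ 2 = m ^ 4 + 48 * g ^ 4)%N,
     (g <= e)%N & m = 2 -> g = 1 -> M = 1 /\ e = 1]%N.
  have ee := odd_double_half e; rewrite -muln2 in ee.
  case oe: (odd e) ee => ee.
    exists (4 * N)%N, (2 * M)%N, e; split=> //.
    - by rewrite coprimeMl cMe coprime2n oe.
    - by lia.
    - by lia.
  rewrite add0n in ee; exists N, M, (e./2); move: (e./2) ee => g ee.
  rewrite -ee in cMe E e0 *; split=> //; first by lia.
  - by move: cMe; rewrite coprimeMr => /andP[].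
  - by rewrite (_ : 48 * g ^ 4 = 3 * (g * 2) ^ 4)%N -?E; ring.
  - by lia.
  - by move=> eM eg; move: cMe; rewrite eM eg.
have [A [B [cAB eg e2]]] := quartic_descent1 g0 cmg e1.
have [A0 B0] : (0 < A)%N /\ (0 < B)%N by apply/andP; rewrite -muln_gt0 -eg.
have [C [F [cCF eB e3]]] := quartic_descent2 B0 cAB e2.
have [C0 F0] : (0 < C)%N /\ (0 < F)%N by apply/andP; rewrite -muln_gt0 -eB.
have [A1 C1 F1] : [/\ A = 1, C = 1 & F = 1]%N.
  (* Since [A C F = g <= e], either [F < e] and induction applies, or [A = C = 1] and [F^2 = F^4]
     remains. *)
  have [ltF|leF] := ltnP F e.
    have [|C1 F1] := IH A C F _ F0 cCF e3; first by lia.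
    split=> //; apply/eqP; rewrite -(@eqn_exp2r _ _ 2) //.
    by move: e3; rewrite C1 F1; lia.
  have AC : (A * C <= 1)%N.
    have leF' : (A * C * F <= 1 * F)%N by rewrite -mulnA -eB -eg; lia.
    by rewrite -(leq_pmul2r F0).
  have [A1 C1] : A = 1%N /\ C = 1%N by clear -AC A0 C0; nia.
  move: e3; rewrite A1 C1 => e3; split=> //; apply/eqP; rewrite eqn_leq F0 andbT leqNgt.
  apply/negP => F2; have : (F ^ 2 < F ^ 4)%N by rewrite ltn_exp2l.
  by lia.
apply: H; last by rewrite eg eB A1 C1 F1.
(* The first descent equation has become [m^2 + 3 = 7]. *)
by apply/eqP; rewrite -(@eqn_exp2r _ _ 2) //; move: e2; rewrite eB A1 C1 F1; lia.
Qed.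

Local Open Scope ring_scope.

Lemma coprime_shift a b m k n : (k + a * m = n + b * m)%N -> coprime m n -> coprime m k.
Proof. by rewrite /coprime -(gcdnMDl b m n) -(gcdnMDl a m k) addnC => ->; rewrite addnC. Qed.

Lemma rat_sqr_nat (r : rat) n : r ^+ 2 = n%:R -> exists m, n = (m ^ 2)%N.
Proof.
move=> e; exists `|numq r|%N.
have d0 : (denq r)%:~R != 0 :> rat by rewrite intr_eq0 denq_neq0.
have e1 : numq r ^+ 2 = n%:Z * denq r ^+ 2.
  apply: (@intr_inj rat); rewrite !expr2 !intrM -pmulrn -e expr2.
  by rewrite -{3 4}[r]divq_num_den; field.
have e2 : (`|numq r| ^ 2 = n * `|denq r| ^ 2)%N.
  by rewrite -!abszX e1 abszM.
suff d1 : `|denq r|%N = 1%N by rewrite e2 d1 muln1.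
have := coprime_num_den r => c.
have : coprime (`|numq r| ^ 2) (`|denq r| ^ 2) by rewrite coprime_pexpl // coprime_pexpr.
by rewrite e2 coprimeMl /coprime gcdnn => /andP[_]; rewrite -[1%N]/(1 ^ 2)%N eqn_exp2r // => /eqP.
Qed.

(* [x = t + 1] turns the curve into [y^2 = x (x^2 - 3 x + 3)]; the factors of the
   right-hand side share at most a factor 3. *)
Lemma rat_cube_add1_sqr (t s : rat) : s ^+ 2 = t ^+ 3 + 1 ->
  [|| t == -1, t == 0 | t == 2].
Proof.
move=> E; have [//|tn1] := eqVneq t (-1); rewrite orFb.
set x := t + 1; have et : t = x - 1 by rewrite /x addrK.
have Ex : s ^+ 2 = x * (x ^+ 2 - 3 * x + 3) by rewrite E et; ring.
have x0 : x != 0 by rewrite addr_eq0.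
have xq : 0 < x ^+ 2 - 3 * x + 3 by nra.
have xp : 0 < x.
  rewrite -(pmulr_lgt0 _ xq) -Ex exprn_even_gt0 //= -sqrf_eq0 Ex.
  by rewrite mulf_neq0 // gt_eqF.
have [p [q [p0 q0 cpq ex]]] : exists p q : nat, [/\ (0 < p)%N, (0 < q)%N, coprime p q &
    x = p%:R / q%:R].
  exists `|numq x|%N, `|denq x|%N; split.
  - by rewrite absz_gt0 numq_eq0.
  - by rewrite absz_gt0 denq_eq0.
  - exact: coprime_num_den.
  - by rewrite -{1}[x]divq_num_den !pmulrn !gez0_abs ?denq_ge0 ?numq_ge0 ?ltW.
have qR : q%:R != 0 :> rat by rewrite pnatr_eq0 -lt0n.
(* [k / q^2] is the quadratic factor at [x = p / q], so [p q k] is a square. *)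
have ek : exists2 k, (k + 3 * p * q = p ^ 2 + 3 * q ^ 2)%N & (0 < k)%N.
  have lt3 : (3 * p * q < p ^ 2 + 3 * q ^ 2)%N.
    by have [h|h] := leqP (3 * q) (2 * p); nia.
  by exists (p ^ 2 + 3 * q ^ 2 - 3 * p * q)%N; lia.
case: ek => k ek k0.
have [r er] : exists r, (p * (q * k) = r ^ 2)%N.
  have ekR : k%:R = p%:R ^+ 2 + 3 * q%:R ^+ 2 - 3 * p%:R * q%:R :> rat.
    by apply/eqP; rewrite eq_sym subr_eq -!natrX -!natrM -!natrD ek.
  have es : (s * q%:R ^+ 2) ^+ 2 = (p * (q * k))%:R.
    by rewrite exprMn Ex ex !natrM ekR; field; exact: qR.
  exact: rat_sqr_nat es.
have sqr2 a b c : (0 < a)%N -> coprime a b -> (a * b = c ^ 2)%N ->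
    exists2 d, (a = d ^ 2)%N & exists e, (b = e ^ 2)%N.
  by move=> a0 cab /(coprime_mul_exp a0 cab)[d ed [e ee _]]; exists d => //; exists e.
have cqk : coprime q k.
  apply: (@coprime_shift (3 * p) (3 * q) _ _ (p ^ 2)); first by lia.
  by rewrite coprime_pexpr // coprime_sym.
(* If 3 divides [p], it divides [k]; removing both factors leaves pairwise coprime squares [p'],
   [q], [k'] and the quartic equation with its two unknowns exchanged, whose trivial solution is
   [x = 3]. The other case gives [x = 1]. *)
have [/dvdnP[p' ep]|n3] := boolP (3 %| p)%N.
  have cp'q : coprime p' q by move: cpq; rewrite ep coprimeMl => /andP[].
  have [k' ek'] : exists k', k = (k' * 3)%N.
    apply/dvdnP; have : (3 %| k + 3 * p * q)%N.
      by rewrite ek ep; lia.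
    by rewrite dvdn_addl // -mulnA dvdn_mulr.
  have cqk' : coprime q k' by move: cqk; rewrite ek' coprimeMr => /andP[].
  have ekk : (k' + 3 * p' * q = q ^ 2 + 3 * p' ^ 2)%N by move: ek; rewrite ep ek'; lia.
  have cpk : coprime p' k'.
    apply: (@coprime_shift (3 * q) (3 * p') _ _ (q ^ 2)); first by lia.
    by rewrite coprime_pexpr.
  have p'0 : (0 < p')%N by lia.
  have [r' er'] : exists r', r = (3 * r')%N.
    have : (3 %| r ^ 2)%N by rewrite -er ep; lia.
    by rewrite Euclid_dvdX // => /andP[/dvdnP[r' ->] _]; exists r'; rewrite mulnC.
  have er2 : (p' * (q * k') = r' ^ 2)%N by move: er; rewrite er' ep ek'; lia.
  have [|M eM [r1 er1]] := sqr2 _ _ _ p'0 _ er2; first by rewrite coprimeMr cp'q.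
  have [e ee [N eN]] := sqr2 _ _ _ q0 cqk' er1.
  have [|||e1 M1] := @quartic_trivial N e M.
  - by move: p'0; rewrite eM expn_gt0 orbF.
  - by move: cp'q; rewrite eM ee coprime_pexpl // coprime_pexpr // coprime_sym.
  - by move: ekk; rewrite eN eM ee; lia.
  by apply/orP; right; rewrite et ex ep eM ee e1 M1.
have c3p : coprime p 3 by rewrite coprime_sym prime_coprime.
have cpk : coprime p k.
  apply: (@coprime_shift (3 * q) p _ _ (3 * q ^ 2)); first by lia.
  by rewrite coprimeMr c3p coprime_pexpr.
have [|M eM [r1 er1]] := sqr2 _ _ _ p0 _ er; first by rewrite coprimeMr cpq.
have [e ee [N eN]] := sqr2 _ _ _ q0 cqk er1.
have [|||M1 e1] := @quartic_trivial N M e.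
- by move: q0; rewrite ee expn_gt0 orbF.
- by move: cpq; rewrite eM ee coprime_pexpl // coprime_pexpr.
- by move: ek; rewrite eN eM ee; lia.
by apply/orP; left; rewrite et ex eM ee e1 M1.
Qed.

(** * 2-adic dynamics of the doubling map *)

(** The 2-adic valuation, with default value 0 at 0; hence the nonvanishing hypotheses below. *)
Definition v2 (x : rat) : int :=
  (logn 2 `|numq x|)%:Z - (logn 2 `|denq x|)%:Z.

Lemma v2_frac (a b : int) : a != 0 -> b != 0 ->
  v2 (a%:~R / b%:~R) = (logn 2 `|a|)%:Z - (logn 2 `|b|)%:Z.
Proof.
move=> a0 b0; set x := _ / _.
have bR : b%:~R != 0 :> rat by rewrite intr_eq0.
have dR : (denq x)%:~R != 0 :> rat by rewrite intr_eq0 denq_neq0.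
have x0 : x != 0 by rewrite mulf_neq0 ?invr_eq0 ?intr_eq0.
have e : (`|a| * `|denq x| = `|numq x| * `|b|)%N.
  rewrite -!abszM; congr absz; apply: (@intr_inj rat); rewrite !intrM.
  have : x = (numq x)%:~R / (denq x)%:~R by rewrite divq_num_den.
  by rewrite {1}/x => /eqP; rewrite eqr_div // => /eqP.
have := congr1 (logn 2) e.
by rewrite !lognM ?absz_gt0 ?denq_neq0 ?numq_eq0 // /v2; lia.
Qed.

Lemma v2_nat n : v2 n%:R = (logn 2 n)%:Z.
Proof. by rewrite /v2 pmulrn numq_int denq_int logn1 subr0. Qed.

Lemma v2_1 : v2 1 = 0. Proof. exact: (v2_nat 1). Qed.

Lemma v2M x y : x != 0 -> y != 0 -> v2 (x * y) = v2 x + v2 y.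
Proof.
move=> x0 y0; rewrite -{1}[x]divq_num_den -{1}[y]divq_num_den mulf_div -!intrM.
rewrite v2_frac ?mulf_neq0 ?denq_neq0 ?numq_eq0 // !abszM.
by rewrite !lognM ?absz_gt0 ?denq_neq0 ?numq_eq0 // /v2; lia.
Qed.

Lemma v2N x : v2 (- x) = v2 x.
Proof. by rewrite /v2 numqN denqN abszN. Qed.

Lemma v2V x : x != 0 -> v2 x^-1 = - v2 x.
Proof.
by move=> x0; apply: (@addrI _ (v2 x)); rewrite -v2M ?invr_eq0 // divff // subrr v2_1.
Qed.

Lemma v2X x n : x != 0 -> v2 (x ^+ n) = v2 x * n%:Z.
Proof.
move=> x0; elim: n => [|n IH]; first by rewrite expr0 mulr0 v2_1.
by rewrite exprS v2M ?expf_neq0 // IH; lia.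
Qed.

(** Over the common denominator [m], a power of 2 dividing both numerators divides their sum. *)
Lemma v2D_ge (k : int) (x y : rat) : x != 0 -> y != 0 -> x + y != 0 -> k <= v2 x -> k <= v2 y ->
  k <= v2 (x + y).
Proof.
move=> x0 y0 xy0.
pose m := denq x * denq y; pose a := numq x * denq y; pose b := numq y * denq x.
have m0 : m != 0 by rewrite mulf_neq0 ?denq_neq0.
have mR : m%:~R != 0 :> rat by rewrite intr_eq0.
have dx : (denq x)%:~R != 0 :> rat by rewrite intr_eq0 denq_neq0.
have dy : (denq y)%:~R != 0 :> rat by rewrite intr_eq0 denq_neq0.
have ex : x = a%:~R / m%:~R.
  by rewrite -{1}[x]divq_num_den !intrM; field; rewrite dx dy.
have ey : y = b%:~R / m%:~R.
  by rewrite -{1}[y]divq_num_den !intrM; field; rewrite dx dy.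
have exy : x + y = (a + b)%:~R / m%:~R by rewrite ex ey intrD -mulrDl.
have nz (c : int) (z : rat) : z != 0 -> z = c%:~R / m%:~R -> c != 0.
  by move=> z0 ez; apply: contraNneq z0 => c0; rewrite ez c0 mul0r.
have a0 := nz _ _ x0 ex; have b0 := nz _ _ y0 ey; have ab0 := nz _ _ xy0 exy.
rewrite exy ex ey !v2_frac // => hx hy.
have [lt0|ge0] := ltP (k + (logn 2 `|m|)%:Z) 0; first by lia.
have [j ej] : exists j : nat, k + (logn 2 `|m|)%:Z = j%:Z.
  by exists `|(k + (logn 2 `|m|)%:Z)%R|%N; rewrite gez0_abs.
have ha : (j <= logn 2 `|a|)%N by lia.
have hb : (j <= logn 2 `|b|)%N by lia.
suff : (j <= logn 2 `|(a + b)%R|)%N by lia.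
move: ha hb; rewrite -!pfactor_dvdn ?absz_gt0 // => ha hb.
have : ((2 ^ j)%N%:Z %| a + b)%Z by rewrite rpredD // dvdzE.
by rewrite dvdzE.
Qed.

(** If the sum had larger valuation, so would [x = (x + y) - y]. *)
Lemma v2D_lt x y : x != 0 -> y != 0 -> v2 x < v2 y -> x + y != 0 /\ v2 (x + y) = v2 x.
Proof.
move=> x0 y0 lt; have xy0 : x + y != 0.
  by apply: contraTneq lt => /eqP; rewrite addr_eq0 => /eqP->; rewrite v2N ltxx.
split=> //; apply/eqP; rewrite eq_le (v2D_ge (k := v2 x)) ?lexx ?(ltW lt) // andbT leNgt.
apply/negP => h; have := @v2D_ge (v2 x + 1) (x + y) (- y); rewrite addrK v2N.
by rewrite oppr_eq0 => /(_ xy0 y0 x0); lia.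
Qed.

Lemma v2_8 : v2 8 = 3. Proof. exact: (v2_nat 8). Qed.
Lemma v2_4 : v2 4 = 2. Proof. exact: (v2_nat 4). Qed.
Lemma v2_2 : v2 2 = 1. Proof. exact: (v2_nat 2). Qed.

(* The abscissa of [2 P] in terms of the abscissa [t] of [P], for [P] on a curve
   [D s^2 = t^3 + 1]. *)
Definition dbl_abscissa (t : rat) : rat := t * (t ^+ 3 - 8) / (4 * (t ^+ 3 + 1)).

(** Abscissas of the points of order 2, 3 and 6; the last two occur only when [D] is a square. *)
Definition torsion_abscissa (t : rat) : bool := [|| t == -1, t == 0 | t == 2].

Lemma cube_sub8_neq0 (t : rat) : t != 2 -> t ^+ 3 - 8 != 0.
Proof.
move=> t2; have -> : t ^+ 3 - 8 = (t - 2) * ((t + 1) ^+ 2 + 3) by ring.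
apply: mulf_neq0; [by rewrite subr_eq0|apply: lt0r_neq0; have := sqr_ge0 (t + 1); lra].
Qed.

Lemma cube_add1_neq0 (t : rat) : t != -1 -> t ^+ 3 + 1 != 0.
Proof.
move=> t2; have -> : t ^+ 3 + 1 = (t + 1) * ((t - 1/2) ^+ 2 + 3/4) by field.
apply: mulf_neq0; [by rewrite addr_eq0|apply: lt0r_neq0; have := sqr_ge0 (t - 1/2); lra].
Qed.

(** For negative valuation [t^3] dominates both [t^3 - 8] and [t^3 + 1], and the 4 in the
    denominator costs 2. At valuation 0, [t^3 - 8] is a unit and [t^3 + 1] is integral. For positive
    valuation [t^3 + 1] is a unit and [t^3 - 8] contributes at least 3. *)
Lemma v2_dbl_abscissa t : ~~ torsion_abscissa t ->
  (v2 t <= 0 -> v2 (dbl_abscissa t) <= v2 t - 2) /\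
  (1 <= v2 t -> 2 <= v2 (dbl_abscissa t) /\ v2 t + 1 <= v2 (dbl_abscissa t)).
Proof.
rewrite /torsion_abscissa !negb_or => /and3P[tn1 t0 t2].
have n0 := cube_sub8_neq0 t2; have d0 := cube_add1_neq0 tn1.
have c0 : t ^+ 3 != 0 by rewrite expf_neq0.
have vc : v2 (t ^+ 3) = v2 t * 3 by rewrite v2X.
have -> : v2 (dbl_abscissa t) = v2 t + v2 (t ^+ 3 - 8) - 2 - v2 (t ^+ 3 + 1).
  have n4 : (4 : rat) != 0 by rewrite pnatr_eq0.
  have h4 : 4 * (t ^+ 3 + 1) != 0 by apply: mulf_neq0.
  rewrite /dbl_abscissa (v2M (mulf_neq0 t0 n0)) ?invr_eq0 // (v2M t0 n0) (v2V h4).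
  by rewrite (v2M n4 d0) v2_4; clear; lia.
have n1 : (1 : rat) != 0 by exact: oner_neq0.
have n8 : (- 8 : rat) != 0 by rewrite oppr_eq0 pnatr_eq0.
have v8 : v2 (- 8) = 3 by rewrite v2N v2_8.
have lt1 : v2 t < 0 -> v2 (t ^+ 3 + 1) = v2 t * 3 /\ v2 (t ^+ 3 - 8) = v2 t * 3.
  move=> h; have [|_ ->] := v2D_lt c0 n1; first by rewrite v2_1 vc; clear -h; lia.
  by have [|_ ->] := v2D_lt c0 n8; rewrite ?v8 vc; [clear -h; lia|].
have eq0 : v2 t = 0 -> 0 <= v2 (t ^+ 3 + 1) /\ v2 (t ^+ 3 - 8) = 0.
  move=> h; split; first by apply: (v2D_ge c0 n1 d0); rewrite ?v2_1 ?vc ?h.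
  by have [|_ ->] := v2D_lt c0 n8; rewrite ?v8 vc h.
have gt1 : 1 <= v2 t -> v2 (t ^+ 3 + 1) = 0.
  move=> h; rewrite addrC.
  by have [|_ ->] := v2D_lt n1 c0; rewrite v2_1 ?vc; [clear -h; lia|].
have ge8 : 1 <= v2 t -> 3 <= v2 (t ^+ 3 - 8).
  move=> h; apply: (v2D_ge c0 n8 n0); last by rewrite v8.
  by rewrite vc; clear -h; lia.
have gt8 : 2 <= v2 t -> v2 (t ^+ 3 - 8) = 3.
  move=> h; rewrite addrC.
  by have [|_ ->] := v2D_lt n8 c0; rewrite v8 ?vc; [clear -h; lia|].
clear vc v8.
split=> h.
  have [/lt1[-> ->]|ge0] := ltP (v2 t) 0; first by lia.
  by have [|h1 ->] := eq0; lia.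
rewrite (gt1 h); have [/gt8->|] := leP 2 (v2 t); first by lia.
by have := ge8 h; lia.
Qed.

(** A doubled abscissa has valuation at most -2 or at least 2, unlike -1 and 2; it is nonzero
    because its numerator is. *)
Lemma dbl_abscissa_nontorsion t : ~~ torsion_abscissa t ->
  ~~ torsion_abscissa (dbl_abscissa t).
Proof.
move=> ht; have [h1 h2] := v2_dbl_abscissa ht.
move: (ht); rewrite /torsion_abscissa !negb_or => /and3P[tn1 t0 t2].
apply/and3P; split; last first.
- by apply/eqP => e; move: h1 h2; rewrite e v2_2; lia.
- rewrite !mulf_neq0 ?invr_eq0 ?mulf_neq0 ?cube_sub8_neq0 ?cube_add1_neq0 //.
- by apply/eqP => e; move: h1 h2; rewrite e v2N v2_1; lia.
Qed.

Lemma iter_dbl_abscissa k t : ~~ torsion_abscissa t ->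
  iter k.+1 dbl_abscissa t <> t.
Proof.
move=> ht e.
have H j : ~~ torsion_abscissa (iter j dbl_abscissa t) /\
   ((v2 t <= 0 -> v2 (iter j dbl_abscissa t) <= v2 t - j%:Z) /\
    (1 <= v2 t -> v2 t + j%:Z <= v2 (iter j dbl_abscissa t))).
  elim: j => [|j [hj [h1 h2]]] /=; first by split=> //; lia.
  split; first exact: dbl_abscissa_nontorsion.
  by have [h3 h4] := v2_dbl_abscissa hj; lia.
have [_ [h1 h2]] := H k.+1; rewrite e in h1 h2.
by have [h|h] := lerP (v2 t) 0; lia.
Qed.

(** * Torsion and rank of the twists *)

(** Every member of an independent family has infinite order, and an element of infinite order is an
    independent family by itself. *)
Lemma abelian_rank_gt0 (G : zmodType) :
  (0 < abelian_rank G)%E <-> exists P : G, forall n, P *+ n.+1 <> 0.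
Proof.
have ind1 n (P : 'I_n -> G) : Zindependent P -> (0 < n)%N ->
    exists Q : G, forall k, Q *+ k.+1 <> 0.
  move=> iP n0; pose i0 := Ordinal n0; exists (P i0) => k e.
  have := iP (fun i => if i == i0 then k.+1%:Z else 0).
  rewrite (bigD1 i0) // eqxx big1 => [|i /negPf->]; last by rewrite mulr0z.
  by rewrite /= addr0 -pmulrn => /(_ e)/(_ i0); rewrite eqxx.
have ind0 (P : 'I_0 -> G) : Zindependent P by move=> c _ [].
rewrite /abelian_rank; case: pselect => [h|h].
  case: (cid h) => r /= [[P iP] hr]; rewrite lte_fin; split=> [r0|[Q hQ]].
    by apply: (ind1 _ P iP); move: r0.
  apply: (hr 1%N (fun=> Q)) => c; rewrite big_ord1 => e i; rewrite [i]ord1.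
  case: (c 0) e => [[|n]|n] // e; first by case: (hQ n).
  by case: (hQ n); apply/eqP; rewrite -oppr_eq0; apply/eqP; exact: e.
split=> [_|_]; last exact: lt0y.
(* Infinite rank: without an element of infinite order only the empty family would be independent,
   and 0 would be the maximal size. *)
apply: contrapT => nQ; apply: h; exists 0%N; split; first by exists (fun=> 0).
move=> n P iP; rewrite leqNgt; apply/negP => n0; apply: nQ; exact: ind1 iP n0.
Qed.

Section Twist.
Variables (D : int) (sqD : squarefree D).
Let d : rat := D%:~R.
Let E := twist36 sqD.

Let d0 : d != 0.
Proof. by rewrite intr_eq0 squarefree_neq0. Qed.

Lemma twist36P (P : ec_point E) x y : ec_val P = Some (x, y) ->
  y ^+ 2 = x ^+ 3 + d ^+ 3.
Proof.
by move=> e; have := ec_valP P; rewrite e /= mul0r addr0 => /eqP.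
Qed.

Lemma twist36_dbl (P : ec_point E) x y : ec_val P = Some (x, y) -> y != 0 ->
  ec_val (P + P) = Some ((3 * x ^+ 2 / (2 * y)) ^+ 2 - x - x,
    3 * x ^+ 2 / (2 * y) * (x - ((3 * x ^+ 2 / (2 * y)) ^+ 2 - x - x)) - y).
Proof.
move=> e y0; rewrite -[ec_val _]/(raw_add 0 (ec_val P) (ec_val P)) e /= eqxx /=.
rewrite -addr_eq0 -mulr2n mulrn_eq0 (negPf y0) /= /line_sum addr0 //.
Qed.

Lemma twist36_dbl_abscissa (P : ec_point E) x y : ec_val P = Some (x, y) ->
  ~~ torsion_abscissa (x / d) ->
  exists x' y', ec_val (P + P) = Some (x', y') /\ x' / d = dbl_abscissa (x / d).
Proof.
move=> e; rewrite /torsion_abscissa !negb_or => /and3P[tn1 _ _].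
have E1 := twist36P e; have c0 := cube_add1_neq0 tn1.
have c0' : x ^+ 3 + d ^+ 3 != 0.
  have -> : x ^+ 3 + d ^+ 3 = d ^+ 3 * ((x / d) ^+ 3 + 1) by field.
  by rewrite mulf_neq0 ?expf_neq0.
have y0 : y != 0 by rewrite -sqrf_eq0 E1.
do 2 eexists; split; first exact: twist36_dbl e y0.
rewrite /dbl_abscissa.
have -> : (3 * x ^+ 2 / (2 * y)) ^+ 2 = 9 * x ^+ 4 / (4 * y ^+ 2) by field.
by rewrite E1; field; rewrite d0 c0'.
Qed.

Lemma twist36_iter_dbl (P : ec_point E) x y k : ec_val P = Some (x, y) ->
  ~~ torsion_abscissa (x / d) ->
  exists x' y', ec_val (P *+ 2 ^ k) = Some (x', y') /\
    x' / d = iter k dbl_abscissa (x / d).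
Proof.
move=> e ht; elim: k => [|k [x' [y' [e' h]]]]; first by exists x, y.
have ht' : ~~ torsion_abscissa (x' / d).
  by rewrite h; elim: (k) => //= j; apply: dbl_abscissa_nontorsion.
have [x2 [y2 [e2 h2]]] := twist36_dbl_abscissa e' ht'.
by exists x2, y2; rewrite expnS mul2n -addnn mulrnDr h2 h.
Qed.

(* A multiple of a torsion point by a power of 2 has odd order [m], hence is
   fixed by multiplication by [2 ^ totient m]. *)
Lemma twist36_nontorsion (P : ec_point E) x y n : ec_val P = Some (x, y) ->
  ~~ torsion_abscissa (x / d) -> P *+ n.+1 <> 0.
Proof.
move=> e ht P0; have [m om en] := pfactor_coprime (isT : prime 2) (ltn0Sn n).
set j := logn 2 n.+1 in en; have m0 : (0 < m)%N by move: (ltn0Sn n); rewrite en muln_gt0 => /andP[].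
have [x1 [y1 [e1 h1]]] := twist36_iter_dbl j e ht.
have ht1 : ~~ torsion_abscissa (x1 / d).
  by rewrite h1; elim: (j) => //= i; apply: dbl_abscissa_nontorsion.
have [x2 [y2 [e2 h2]]] := twist36_iter_dbl (totient m) e1 ht1.
have t0 : (0 < totient m)%N by rewrite totient_gt0.
apply: (@iter_dbl_abscissa (totient m).-1 (x1 / d) ht1); rewrite prednK // -h2.
suff ee : P *+ 2 ^ j *+ 2 ^ totient m = P *+ 2 ^ j by move: e2; rewrite ee e1 => -[->].
have := Euler_exp_totient om; set w := (2 ^ totient m)%N => ew.
have w0 : (0 < w)%N by rewrite expn_gt0.
have : (m %| w - 1)%N by rewrite -eqn_mod_dvd //; apply/eqP.
case/dvdnP => q eq; have -> : w = (q * m + 1)%N by lia.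
rewrite mulrnDr mulr1n -[RHS]add0r; congr (_ + _).
by rewrite -mulrnA mulnC -mulnA -en mulnC mulrnA P0 mul0rn.
Qed.

(** The point is a flex with horizontal tangent, so [2 P = - P]. *)
Lemma twist36_x0 (P : ec_point E) y : ec_val P = Some (0, y) -> P *+ 3 = 0.
Proof.
move=> e; have E1 := twist36P e.
have y0 : y != 0 by rewrite -sqrf_eq0 E1 expr0n add0r expf_neq0.
have : P + P = - P.
  apply: val_inj; rewrite -[LHS]/(ec_val (P + P)) (twist36_dbl e y0).
  rewrite -[RHS]/(raw_opp (ec_val P)) e /= expr0n /= !(mulr0, mul0r, expr0n, subr0, sub0r) //=.
by rewrite mulrS mulr2n => ->; rewrite subrr.
Qed.

(** Abscissa [-d] means [y = 0], hence order 2; a point of abscissa [2 d] doubles to abscissa 0. *)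
Lemma twist36_torsion (P : ec_point E) x y : ec_val P = Some (x, y) ->
  torsion_abscissa (x / d) -> P *+ 6 = 0.
Proof.
move=> e; have E1 := twist36P e; rewrite (mulrnA P 2 3).
have xE u : (x / d == u) = (x == u * d) by rewrite -(can_eq (mulfK d0)) divfK.
case/or3P; rewrite xE => /eqP ex; rewrite ex in e E1.
- have y0 : y = 0.
    by apply/eqP; rewrite -sqrf_eq0 E1; apply/eqP; ring.
  have -> : P *+ 2 = 0; last by rewrite mul0rn.
  apply: val_inj; rewrite mulr2n -[LHS]/(raw_add 0 (ec_val P) (ec_val P)) e y0 /=.
  by rewrite oppr0 !eqxx.
- by rewrite mul0r in e; rewrite -mulrnA mulnC mulrnA (twist36_x0 e) mul0rn.
have y0 : y != 0.
  rewrite -sqrf_eq0 E1.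
  have -> : (2 * d) ^+ 3 + d ^+ 3 = 9 * d ^+ 3 by ring.
  by rewrite mulf_neq0 ?expf_neq0.
have := twist36_dbl e y0; rewrite -mulr2n.
have -> : (3 * (2 * d) ^+ 2 / (2 * y)) ^+ 2 - 2 * d - 2 * d = 0.
  have -> : (3 * (2 * d) ^+ 2 / (2 * y)) ^+ 2 = 36 * d ^+ 4 / y ^+ 2 by field.
  rewrite E1.
  have -> : (2 * d) ^+ 3 + d ^+ 3 = 9 * d ^+ 3 by ring.
  by field.
exact: twist36_x0.
Qed.

Lemma twist36_rank_gt0 : (0 < abelian_rank (ec_point E))%E <->
  exists x y : rat, y ^+ 2 = x ^+ 3 + d ^+ 3 /\ ~~ torsion_abscissa (x / d).
Proof.
rewrite abelian_rank_gt0; split=> [[P hP]|[x [y [e ht]]]].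
  case eP : (ec_val P) => [[x y]|]; last first.
    by case: (hP 0%N); apply: val_inj.
  exists x, y; split; first exact: twist36P eP.
  by apply/negP => /(twist36_torsion eP); apply: hP.
have h : on_curve (ec_a E) (ec_b E) (Some (x, y)) by rewrite /= mul0r addr0 e.
exists (ECPoint h) => n; exact: (@twist36_nontorsion (ECPoint h) x y).
Qed.

End Twist.

(** * Points over quadratic fields *)

Lemma rat_cube_neq2 (p : rat) : p ^+ 3 <> 2.
Proof.
move=> e; have p0 : p != 0 by apply: contra_eq_neq e => ->; rewrite expr0n.
by have := congr1 v2 e; rewrite v2X // v2_2; lia.
Qed.

Lemma twist_point_scale (D x y : rat) : D != 0 -> D * y ^+ 2 = x ^+ 3 + 1 ->
  (D ^+ 2 * y) ^+ 2 = (D * x) ^+ 3 + D ^+ 3 /\ D * x / D = x.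
Proof.
move=> D0 e; split; last by field.
have -> : (D ^+ 2 * y) ^+ 2 = D ^+ 3 * (D * y ^+ 2) by ring.
by rewrite e; ring.
Qed.

(** At [x = 0] and [x = 2] the value [D y^2] is 1 or 9, making [D] the square of [1 / y] or
    [3 / y]. *)
Lemma twist_point_trivial (D x y : rat) : (forall r, r ^+ 2 <> D) ->
  D * y ^+ 2 = x ^+ 3 + 1 -> torsion_abscissa x -> x = -1.
Proof.
move=> nsq e; have sq (r : rat) : r != 0 -> D * y ^+ 2 != r ^+ 2.
  move=> r0; apply/eqP => e1; have y0 : y != 0.
    by apply: contraNneq r0 => y0; rewrite -sqrf_eq0 -e1 y0 expr0n mulr0.
  by apply: (nsq (r / y)); rewrite expr_div_n -e1 mulfK ?expf_neq0.
case/or3P => /eqP ex //; rewrite ex in e.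
  by have /eqP[] := sq 1 isT; rewrite e; ring.
by have /eqP[] := sq 3 isT; rewrite e; ring.
Qed.

Section QuadraticPoint.
Variables (D a b c d : rat).
Hypothesis nsq : forall r, r ^+ 2 <> D.
(** [E1] and [E2] are the two coordinates of [s^2 = t^3 + 1] for [t = a + b sqrt D],
    [s = c + d sqrt D]; [nt] excludes rational [s] with [t^3] equal to -1, 0 or 8. *)
Hypothesis E1 : c ^+ 2 + d ^+ 2 * D = a ^+ 3 + 3 * a * b ^+ 2 * D + 1.
Hypothesis E2 : 2 * c * d = 3 * a ^+ 2 * b + b ^+ 3 * D.
Hypothesis nt : d = 0 -> [/\ c ^+ 2 <> 0, c ^+ 2 <> 1 & c ^+ 2 <> 9].

Let D0 : D != 0.
Proof. by apply/eqP => e; apply: (nsq (r := 0)); rewrite e expr0n. Qed.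

(* The hypotheses say that the sum and the difference of the point and its
   conjugate have abscissas [x] and [-1]; both are then torsion and so is the point. *)
Lemma conjugate_sum_diff_torsion x : b != 0 -> torsion_abscissa x ->
  d ^+ 2 = (2 * a + x) * b ^+ 2 -> c ^+ 2 = (2 * a - 1) * (b ^+ 2 * D) -> False.
Proof.
move=> b0 hx hd hc; set B := b ^+ 2 * D in hc *.
(* [F1] is [E1] and [F2] the square of [E2] after substituting [c^2] and [d^2]; each case below
   eliminates [B] between them. *)
have F1 : (a - 1 + x) * B = a ^+ 3 + 1.
  have : (2 * a - 1) * B + (2 * a + x) * B = a ^+ 3 + 3 * a * B + 1.
    by rewrite -hc /B mulrA -hd E1; ring.
  by move=> h; apply/eqP; rewrite -subr_eq0; apply/eqP; lra.
have F2 : 4 * (2 * a - 1) * (2 * a + x) * B = (3 * a ^+ 2 + B) ^+ 2.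
  apply: (@mulfI _ (b ^+ 2)); first by rewrite expf_neq0.
  have -> : b ^+ 2 * (4 * (2 * a - 1) * (2 * a + x) * B) =
     4 * ((2 * a - 1) * B) * ((2 * a + x) * b ^+ 2) by ring.
  rewrite -hc -hd.
  have -> : 4 * c ^+ 2 * d ^+ 2 = (2 * c * d) ^+ 2 by ring.
  by rewrite E2 /B; ring.
case/or3P: hx => /eqP ex; rewrite ex in F1 F2 hd.
(* Elimination leaves [9 (2 a - 1)^2 = 0], so [c = d = 0]. *)
- have G : (2 * a - 1) ^+ 2 = 0.
    have : 4 * (2 * a - 1) ^+ 2 * (a - 2) * ((a - 1 + -1) * B) =
       (3 * a ^+ 2 * (a - 2) + (a - 1 + -1) * B) ^+ 2.
      have -> : (3 * a ^+ 2 * (a - 2) + (a - 1 + -1) * B) ^+ 2 =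
        (a - 2) ^+ 2 * (3 * a ^+ 2 + B) ^+ 2 by ring.
      by rewrite -F2; ring.
    by rewrite F1 => h; lra.
  have /eqP e2 : 2 * a - 1 == 0 by rewrite -sqrf_eq0 G.
  have d0 : d = 0.
    by apply/eqP; rewrite -sqrf_eq0 hd e2 mul0r.
  by have [] := nt d0; rewrite hc e2 mul0r.
(* Elimination leaves this perfect square, and 3 would be a rational square. *)
- have G : ((a - 2) ^+ 2 - 3) ^+ 2 = 0.
    have : 4 * (2 * a - 1) * (2 * a) * (a - 1) * ((a - 1 + 0) * B) =
       (3 * a ^+ 2 * (a - 1) + (a - 1 + 0) * B) ^+ 2.
      have -> : (3 * a ^+ 2 * (a - 1) + (a - 1 + 0) * B) ^+ 2 =
        (a - 1) ^+ 2 * (3 * a ^+ 2 + B) ^+ 2 by ring.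
      by rewrite -F2; ring.
    by rewrite F1 => h; lra.
  have /eqP e2 : (a - 2) ^+ 2 - 3 == 0 by rewrite -sqrf_eq0 G.
  have e3 : (a - 2) ^+ 2 = 3%:R by lra.
  have [m em] := rat_sqr_nat e3.
  by case: m em => [|[|m]] //; rewrite -mulnn mulnS; lia.
(* [F1] factors: [a = -1] leads to [d = 0] and [c^2 = 9], the other factor to [a = 1] and
   [b^2 D = 1]. *)
have : (a + 1) * (B - (a ^+ 2 - a + 1)) = 0 by lra.
move/eqP; rewrite mulf_eq0 subr_eq0 addr_eq0 => /orP[] /eqP e2.
  have d0 : d = 0 by apply/eqP; rewrite -sqrf_eq0 hd e2; apply/eqP; ring.
  have [_ _] := nt d0; apply; rewrite hc.
  have : (3 + B) ^+ 2 = 0.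
    have -> : 3 + B = 3 * a ^+ 2 + B by rewrite e2; ring.
    by rewrite -F2 e2; ring.
  move/eqP; rewrite sqrf_eq0 => /eqP; rewrite e2; lra.
have : (a - 1) ^+ 2 = 0 by move: F2; rewrite e2; lra.
move/eqP; rewrite sqrf_eq0 subr_eq0 => /eqP a1.
apply: (nsq (r := b^-1)).
have B1 : b ^+ 2 * D = 1 by rewrite -/B e2 a1; ring.
by apply: (@mulfI _ (b ^+ 2)); rewrite ?expf_neq0 // B1 exprVn divff ?expf_neq0.
Qed.

Lemma quadratic_point_twist :
  exists x y, D * y ^+ 2 = x ^+ 3 + 1 /\ ~~ torsion_abscissa x.
Proof.
(* For rational [t], either [c = 0] and the point already lies on the twist, or [d = 0] and the
   descent over the rationals contradicts [nt]. *)
have [b0|b0] := eqVneq b 0.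
  have /eqP : c * d = 0 by move: E2; rewrite b0; lra.
  rewrite mulf_eq0 => /orP[] /eqP z0.
    have e : D * d ^+ 2 = a ^+ 3 + 1 by move: E1; rewrite b0 z0; lra.
    exists a, d; split=> //; apply/negP => /(twist_point_trivial nsq e) ea.
    have d0 : d = 0.
      apply/eqP; rewrite -sqrf_eq0 -[_ == 0]orFb -(negPf D0) -mulf_eq0 e ea.
      by apply/eqP; ring.
    by have [] := nt d0; rewrite z0 expr0n.
  have e : c ^+ 2 = a ^+ 3 + 1 by move: E1; rewrite b0 z0; lra.
  have [n0 n1 n9] := nt z0.
  by case/or3P: (rat_cube_add1_sqr e) => /eqP ea; [case: n0|case: n1|case: n9]; rewrite e ea; ring.
(* Abscissas of [P + P'] and [P - P']: the chords have slopes [d / b] and [c / (b sqrt D)], and the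
   abscissas of [P] and [P'] sum to [2 a]. *)
pose x := (d / b) ^+ 2 - 2 * a; pose x' := c ^+ 2 / (b ^+ 2 * D) - 2 * a.
have hd : d ^+ 2 = (2 * a + x) * b ^+ 2 by rewrite /x; field.
have hc : c ^+ 2 = (2 * a + x') * (b ^+ 2 * D) by rewrite /x'; field; rewrite b0 D0.
have E2' : 2 * c * d / b = 3 * a ^+ 2 + b ^+ 2 * D by rewrite E2; field.
have Ex : (d / b * (x - a) + c) ^+ 2 = x ^+ 3 + 1.
  have -> : (d / b * (x - a) + c) ^+ 2 =
    (x + 2 * a) * (x - a) ^+ 2 + 2 * c * d / b * (x - a) + c ^+ 2 by rewrite /x; field.
  have -> : c ^+ 2 = a ^+ 3 + 3 * a * b ^+ 2 * D + 1 - d ^+ 2 * D by rewrite -E1; ring.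
  by rewrite E2' hd; ring.
have Ex' : D * (c / (b * D) * (x' - a) + d) ^+ 2 = x' ^+ 3 + 1.
  have -> : D * (c / (b * D) * (x' - a) + d) ^+ 2 =
    (x' + 2 * a) * (x' - a) ^+ 2 + 2 * c * d / b * (x' - a) + d ^+ 2 * D.
    by rewrite /x'; field; rewrite b0 D0.
  have -> : d ^+ 2 * D = a ^+ 3 + 3 * a * b ^+ 2 * D + 1 - c ^+ 2 by rewrite -E1; ring.
  by rewrite E2' hc; ring.
have tx := rat_cube_add1_sqr Ex.
have [tx'|ntx'] := boolP (torsion_abscissa x'); last by do 2 eexists; split; [exact: Ex'|].
have ex' := twist_point_trivial nsq Ex' tx'.
by case: (conjugate_sum_diff_torsion b0 tx hd); rewrite hc ex'.
Qed.

End QuadraticPoint.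

(** * Coordinates and cube roots in Q(sqrt D) *)

Lemma ratr_inj (p q : rat) : ratr p = ratr q :> algC -> p = q.
Proof. exact: fmorph_inj. Qed.

Lemma Qsqrt_coord_inj (D : int) : (forall r : rat, r ^+ 2 <> D%:~R) ->
  forall p q u v : rat,
  ratr p + ratr q * sqrtC D%:~R = ratr u + ratr v * sqrtC D%:~R :> algC ->
  p = u /\ q = v.
Proof.
move=> nsq p q u v e.
have [eq|nq] := eqVneq q v.
  by split=> //; move: e; rewrite eq => /addIr/fmorph_inj.
case: (nsq ((u - p) / (q - v))); apply: ratr_inj.
have nq' : ratr q - ratr v != 0 :> algC by rewrite -rmorphB fmorph_eq0 subr_eq0.
rewrite rmorphXn fmorph_div !rmorphB /= ratr_int.
suff -> : (ratr u - ratr p) / (ratr q - ratr v) = sqrtC D%:~R :> algC by rewrite sqrtCK.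
apply: (@mulIf _ (ratr q - ratr v)) => //; rewrite divfK // mulrBr.
have -> : ratr u = ratr p + ratr q * sqrtC D%:~R - ratr v * sqrtC D%:~R :> algC.
  by rewrite e addrK.
by ring.
Qed.

(** Serves [D = 1], the only squarefree square, where the field is just Q. *)
Lemma in_Qsqrt_square (D : int) (r : rat) z : r ^+ 2 = D%:~R -> z \in in_Qsqrt D ->
  exists p : rat, z = ratr p.
Proof.
move=> er /asboolP[p [q ->]].
have : (sqrtC D%:~R) ^+ 2 == (ratr r) ^+ 2 :> algC.
  by rewrite sqrtCK -rmorphXn er /= ratr_int.
rewrite eqf_sqr => /orP[] /eqP->.
  by exists (p + q * r); rewrite rmorphD rmorphM.
by exists (p - q * r); rewrite rmorphB rmorphM mulrN.
Qed.

(** For [z = p + q sqrt D] with [q] nonzero, the vanishing irrational part of [z^3] gives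
    [q^2 D = -3 p^2], and the rational part becomes [(-2 p)^3]: again a rational cube root of 2. *)
Lemma Qsqrt_cube_neq2 (D : int) (z : algC) : z \in in_Qsqrt D -> z ^+ 3 <> 2.
Proof.
move=> hz e; have [[r er]|nsq] := pselect (exists r : rat, r ^+ 2 = D%:~R).
  have [p ep] := in_Qsqrt_square er hz; apply: (@rat_cube_neq2 p).
  by apply: ratr_inj; rewrite rmorphXn /= -ep e rmorph_nat.
have {}nsq r : r ^+ 2 <> D%:~R :> rat by move=> er; apply: nsq; exists r.
case/asboolP: hz => p [q ez]; rewrite ez in e.
have s2 : sqrtC D%:~R ^+ 2 = ratr D%:~R :> algC by rewrite sqrtCK ratr_int.
have [|e1 e2] := @Qsqrt_coord_inj D nsq (p ^+ 3 + 3 * p * q ^+ 2 * D%:~R)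
   (3 * p ^+ 2 * q + q ^+ 3 * D%:~R) 2 0.
  rewrite rmorph0 mul0r addr0 rmorph_nat -e !(rmorphD, rmorphM, rmorphXn, rmorph_nat) /= -s2.
  by ring.
have [q0|q0] := eqVneq q 0.
  by apply: (@rat_cube_neq2 p); rewrite -e1 q0; ring.
have e3 : q ^+ 2 * D%:~R = - 3 * p ^+ 2.
  apply: (@mulIf _ q) => //; apply/eqP; rewrite -subr_eq0 -e2; apply/eqP; ring.
apply: (@rat_cube_neq2 (- 2 * p)); rewrite -[RHS]e1.
have -> : 3 * p * q ^+ 2 * D%:~R = 3 * p * (q ^+ 2 * D%:~R) by ring.
by rewrite e3; ring.
Qed.

Lemma cubes_AP_twist_point (D : int) (t s : algC) :
  t \in in_Qsqrt D -> s \in in_Qsqrt D -> s ^+ 2 = t ^+ 3 + 1 ->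
  s ^+ 2 != 0 -> s ^+ 2 != 1 -> s ^+ 2 != 9 ->
  exists x y : rat, D%:~R * y ^+ 2 = x ^+ 3 + 1 /\ ~~ torsion_abscissa x.
Proof.
move=> ht hs e n0 n1 n9.
have [[r er]|nsq] := pselect (exists r : rat, r ^+ 2 = D%:~R).
  have [a ea] := in_Qsqrt_square er ht; have [c ec] := in_Qsqrt_square er hs.
  have e1 : c ^+ 2 = a ^+ 3 + 1.
    by apply: ratr_inj; rewrite rmorphD !rmorphXn rmorph1 /= -ea -ec.
  rewrite e ea in n0 n1 n9.
  case/or3P: (rat_cube_add1_sqr e1) => /eqP a0; rewrite a0 in n0 n1 n9.
  - by move/eqP: n0; case; rewrite rmorphN rmorph1; ring.
  - by move/eqP: n1; case; rewrite rmorph0; ring.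
  - by move/eqP: n9; case; rewrite rmorph_nat; ring.
have {}nsq r : r ^+ 2 <> D%:~R :> rat by move=> er; apply: nsq; exists r.
have s2 : sqrtC D%:~R ^+ 2 = ratr D%:~R :> algC by rewrite sqrtCK ratr_int.
case/asboolP: ht => a [b ea]; case/asboolP: hs => c [d ec].
have [|E1 E2] := @Qsqrt_coord_inj D nsq (c ^+ 2 + d ^+ 2 * D%:~R) (2 * c * d)
  (a ^+ 3 + 3 * a * b ^+ 2 * D%:~R + 1) (3 * a ^+ 2 * b + b ^+ 3 * D%:~R).
  move: e; rewrite ea ec !(rmorphD, rmorphM, rmorphXn, rmorph_nat, rmorph1) /= -s2 => e.
  have -> : forall S c d : algC, c ^+ 2 + d ^+ 2 * S ^+ 2 + 2 * c * d * S = (c + d * S) ^+ 2.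
    by move=> *; ring.
  by rewrite e; ring.
apply: (quadratic_point_twist nsq E1 E2) => d0.
have es : s ^+ 2 = ratr (c ^+ 2) by rewrite ec d0 rmorph0 mul0r addr0 rmorphXn.
by split=> ee; [case/eqP: n0|case/eqP: n1|case/eqP: n9];
  rewrite es ee ?rmorph0 ?rmorph1 ?rmorph_nat.
Qed.

(* This is the rational 3-isogeny from [x0^3 + x2^3 = 2 x1^3] to [s^2 = t^3 + 1]:
   for [x1 = 1], [s] is the half difference of the outer cubes and [-t] is the
   product of their roots. *)
Lemma cubes_AP_to_curve (k : fieldType) (x0 x1 x2 : k) : (2 : k) != 0 -> x1 != 0 ->
  x1 ^+ 3 - x0 ^+ 3 = x2 ^+ 3 - x1 ^+ 3 ->
  ((x2 ^+ 3 - x0 ^+ 3) / (2 * x1 ^+ 3)) ^+ 2 = (- (x0 * x2) / x1 ^+ 2) ^+ 3 + 1.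
Proof.
move=> h2 x1n e.
have e2 : x2 ^+ 3 = 2 * x1 ^+ 3 - x0 ^+ 3.
  by rewrite -[LHS](subrK (x1 ^+ 3)) -e; ring.
have -> : (- (x0 * x2) / x1 ^+ 2) ^+ 3 = - (x0 ^+ 3 * x2 ^+ 3) / x1 ^+ 6 by field.
by rewrite e2; field; rewrite x1n h2.
Qed.

(** The dual isogeny: followed by the map of [cubes_AP_to_curve] it is multiplication by 3 up to
    sign, and [x1] is the 3-division polynomial. With [v = t^3] it rests on
    [(v + 4)^3 = 27 v^2 + (v + 1) (v - 8)^2]. *)
Lemma cubes_AP_of_curve (k : fieldType) (t s : k) : s ^+ 2 = t ^+ 3 + 1 ->
  let x0 := 9 * t ^+ 3 - s * (t ^+ 3 - 8) in
  let x1 := 3 * t * (t ^+ 3 + 4) in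
  let x2 := 9 * t ^+ 3 + s * (t ^+ 3 - 8) in
  x1 ^+ 3 - x0 ^+ 3 = x2 ^+ 3 - x1 ^+ 3.
Proof.
move=> e /=; apply/eqP; rewrite -subr_eq0; apply/eqP.
set u := t ^+ 3 - 8; set v := t ^+ 3.
have -> : (3 * t * (v + 4)) ^+ 3 - (9 * v - s * u) ^+ 3 -
    ((9 * v + s * u) ^+ 3 - (3 * t * (v + 4)) ^+ 3) =
   54 * t ^+ 3 * (v + 4) ^+ 3 - 54 * v * (27 * v ^+ 2 + s ^+ 2 * u ^+ 2) by ring.
by rewrite e /u /v; ring.
Qed.

(** This factor of [x2^3 - x0^3] must not vanish for the progression to be nonconstant. In [c = t^3]
    it is [c^3 + 228 c^2 + 48 c + 64], where a single term has least 2-adic valuation: [c^3] if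
    [v2 t <= 0], otherwise 64. *)
Lemma cubes_AP_of_curve_neq0 (t : rat) :
  243 * t ^+ 6 + (t ^+ 3 + 1) * (t ^+ 3 - 8) ^+ 2 != 0.
Proof.
have [->|t0] := eqVneq t 0.
  have -> : 243 * 0 ^+ 6 + (0 ^+ 3 + 1) * (0 ^+ 3 - 8) ^+ 2 = 64%:R :> rat by ring.
  by rewrite pnatr_eq0.
set c := t ^+ 3; have c0 : c != 0 by rewrite expf_neq0.
have vc : v2 c = v2 t * 3 by rewrite v2X.
have l228 : logn 2 228 = 2%N by [].
have l48 : logn 2 48 = 4%N by [].
have n228' : (228 : rat) != 0 by rewrite pnatr_eq0.
have n48' : (48 : rat) != 0 by rewrite pnatr_eq0.
have n64 : (64 : rat) != 0 by rewrite pnatr_eq0.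
have n2 : c ^+ 2 != 0 by rewrite expf_neq0.
have v228 : v2 (228 * c ^+ 2) = v2 t * 6 + 2.
  by rewrite (v2M n228' n2) (v2X _ c0) (v2_nat 228) l228 vc; clear; lia.
have v48 : v2 (48 * c) = v2 t * 3 + 4.
  by rewrite (v2M n48' c0) (v2_nat 48) l48 vc; clear; lia.
have v64 : v2 64 = 6 by rewrite (v2_nat 64).
have vc3 : v2 (c ^+ 3) = v2 t * 9 by rewrite (v2X _ c0) vc; clear; lia.
have n228 : 228 * c ^+ 2 != 0 by apply: mulf_neq0.
have n48 : 48 * c != 0 by apply: mulf_neq0.
have n3 : c ^+ 3 != 0 by rewrite expf_neq0.
have -> : t ^+ 6 = c ^+ 2 by rewrite /c; ring.
have [h|h] := leP (v2 t) 0.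
  have -> : 243 * c ^+ 2 + (c + 1) * (c - 8) ^+ 2 = c ^+ 3 + 228 * c ^+ 2 + 48 * c + 64 by ring.
  have [|m1 w1] := v2D_lt n3 n228; first by rewrite vc3 v228; clear -h; lia.
  have [|m2 w2] := v2D_lt m1 n48; first by rewrite w1 vc3 v48; clear -h; lia.
  by have [|m3 w3] := v2D_lt m2 n64; first by rewrite w2 w1 vc3 v64; clear -h; lia.
have -> : 243 * c ^+ 2 + (c + 1) * (c - 8) ^+ 2 = 64 + 48 * c + 228 * c ^+ 2 + c ^+ 3 by ring.
have [|m1 w1] := v2D_lt n64 n48; first by rewrite v64 v48; clear -h; lia.
have [|m2 w2] := v2D_lt m1 n228; first by rewrite w1 v64 v228; clear -h; lia.
by have [|m3 w3] := v2D_lt m2 n3; first by rewrite w2 w1 v64 vc3; clear -h; lia.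
Qed.

Lemma rat_cube_add4_neq0 (t : rat) : t ^+ 3 + 4 != 0.
Proof.
have [->|t0] := eqVneq t 0; first by rewrite expr0n add0r pnatr_eq0.
rewrite addr_eq0; apply/eqP => /(congr1 v2).
by rewrite (v2X _ t0) v2N v2_4; lia.
Qed.

Lemma Qsqrt_nat_neq0 (D : int) n : (n.+1%:R : Qsqrt D) != 0.
Proof. by rewrite -(inj_eq val_inj) rmorph_nat rmorph0 pnatr_eq0. Qed.

Theorem theorem7 (D : int) (sqD : squarefree D) :
  has_nontrivial_cubes_AP (Qsqrt D) <->
  (0 < abelian_rank (ec_point (twist36 sqD)))%E.
Proof.
have D0 : D%:~R != 0 :> rat by rewrite intr_eq0 squarefree_neq0.
rewrite twist36_rank_gt0; split=> [[x0 [x1 [x2 [[_ e] nt]]]]|[X [Y [eXY ht]]]].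
  have x1n : x1 != 0 by apply/eqP => x10; apply: nt; right.
  have n2 := Qsqrt_nat_neq0 D 1.
  have eq2 := cubes_AP_to_curve n2 x1n e.
  set s := (_ / _ : Qsqrt D) in eq2; set t := (_ / _ : Qsqrt D) in eq2.
  have c3 : x1 ^+ 3 != 0 by rewrite expf_neq0.
  have nocube (z : Qsqrt D) : z ^+ 3 <> 2.
    move=> ez; apply: (@Qsqrt_cube_neq2 D (Qsqrt_val z) (Qsqrt_valP z)).
    by have := congr1 (val : Qsqrt D -> algC) ez; rewrite rmorphXn rmorph_nat.
  have e2 : x2 ^+ 3 = 2 * x1 ^+ 3 - x0 ^+ 3.
    by rewrite -[LHS](subrK (x1 ^+ 3)) -e; ring.
  have es0 : s = 1 - (x0 / x1) ^+ 3 by rewrite /s e2; field; rewrite x1n.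
  have es2 : s = (x2 / x1) ^+ 3 - 1 by rewrite expr_div_n e2 es0; field.
  (* [s = 0] is the constant progression; if [s] is 1, -1, 3 or -3, then [x2 / x1], [x0 / x1],
     [- x0 / x1] or [- x2 / x1] respectively is a cube root of 2. *)
  have s0 : s ^+ 2 != 0%:R.
    rewrite sqrf_eq0; apply/eqP => sz; apply: nt; left.
    have e01 : x0 ^+ 3 = x1 ^+ 3.
      rewrite -[LHS](divfK c3) -expr_div_n -[(x0 / x1) ^+ 3](subKr 1) -es0 sz.
      by rewrite subr0 mul1r.
    by rewrite e2 e01; split=> //; ring.
  have s1 : s ^+ 2 != 1%:R.
    rewrite sqrf_eq1; apply/norP; split; apply/eqP => sz.
      by apply: (nocube (x2 / x1)); rewrite -[LHS](subrK 1) -es2 sz; ring.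
    by apply: (nocube (x0 / x1)); rewrite -[LHS](subKr 1) -es0 sz; ring.
  have s9 : s ^+ 2 != 9%:R.
    have -> : 9%:R = 3 ^+ 2 :> Qsqrt D by ring.
    rewrite eqf_sqr; apply/norP; split; apply/eqP => sz.
      apply: (nocube (- (x0 / x1))).
      have -> : (- (x0 / x1)) ^+ 3 = (1 - (x0 / x1) ^+ 3) - 1 by ring.
      by rewrite -es0 sz; ring.
    apply: (nocube (- (x2 / x1))).
    have -> : (- (x2 / x1)) ^+ 3 = - ((x2 / x1) ^+ 3 - 1) - 1 by ring.
    by rewrite -es2 sz; ring.
  have sv n : s ^+ 2 != n%:R -> val s ^+ 2 != n%:R :> algC.
    have -> : n%:R = val (n%:R : Qsqrt D) :> algC by rewrite rmorph_nat.
    by rewrite -rmorphXn (inj_eq val_inj).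
  have [|x [y [exy nx]]] := @cubes_AP_twist_point D (val t) (val s)
      (Qsqrt_valP t) (Qsqrt_valP s) _ (sv _ s0) (sv _ s1) (sv _ s9).
    by rewrite -!rmorphXn eq2 rmorphD rmorph1.
  have [e3 e4] := twist_point_scale D0 exy.
  by exists (D%:~R * x), (D%:~R ^+ 2 * y); rewrite e4.
(* Conversely, [(x, y sqrt D)] lies on [s^2 = t^3 + 1] over Q(sqrt D), and the dual isogeny turns it
   into a progression. *)
pose x := X / D%:~R; pose y := Y / D%:~R ^+ 2.
have exy : D%:~R * y ^+ 2 = x ^+ 3 + 1.
  have -> : D%:~R * y ^+ 2 = Y ^+ 2 / D%:~R ^+ 3 by rewrite /y; field.
  by rewrite eXY /x; field.
have ht' : ratr x \in in_Qsqrt D.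
  by apply/asboolP; exists x, 0; rewrite rmorph0 mul0r addr0.
have hs' : ratr y * sqrtC D%:~R \in in_Qsqrt D.
  by apply/asboolP; exists 0, y; rewrite rmorph0 add0r.
pose t : Qsqrt D := InQsqrt ht'; pose s : Qsqrt D := InQsqrt hs'.
have est : s ^+ 2 = t ^+ 3 + 1.
  apply: val_inj; rewrite rmorphD !rmorphXn rmorph1 /= exprMn sqrtCK mulrC.
  by rewrite -(ratr_int algC D) -rmorphXn -rmorphM exy rmorphD rmorph1 rmorphXn.
move: ht; rewrite /torsion_abscissa !negb_or -/x => /and3P[xn1 xn0 xn2].
have nz (p : rat) (z : Qsqrt D) : val z = ratr p -> p != 0 -> z != 0.
  move=> ez; apply: contraNneq => z0; apply/eqP/ratr_inj.
  by rewrite -ez z0 !rmorph0.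
have t0 : t != 0 by apply: (nz x).
have t4 : t ^+ 3 + 4 != 0.
  apply: (nz (x ^+ 3 + 4)); last exact: rat_cube_add4_neq0.
  by rewrite !(rmorph_nat, rmorphD, rmorphXn).
have v8 : val (t ^+ 3 - 8) = ratr (x ^+ 3 - 8) :> algC.
  by rewrite !(rmorph_nat, rmorphB, rmorphXn).
have t8 : t ^+ 3 - 8 != 0 by apply: nz v8 _; exact: cube_sub8_neq0.
have v1 : val (t ^+ 3 + 1) = ratr (x ^+ 3 + 1) :> algC.
  by rewrite !(rmorph1, rmorphD, rmorphXn).
have t1 : t ^+ 3 + 1 != 0 by apply: nz v1 _; exact: cube_add1_neq0.
have tq : 243 * t ^+ 6 + (t ^+ 3 + 1) * (t ^+ 3 - 8) ^+ 2 != 0.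
  apply: (nz (243 * x ^+ 6 + (x ^+ 3 + 1) * (x ^+ 3 - 8) ^+ 2)); last first.
    exact: cubes_AP_of_curve_neq0.
  rewrite [LHS]rmorphD [RHS]rmorphD; congr (_ + _).
    by rewrite [LHS]rmorphM [RHS]rmorphM; congr (_ * _); rewrite ?rmorph_nat ?rmorphXn.
  rewrite [LHS]rmorphM [RHS]rmorphM; congr (_ * _); first exact: v1.
  by rewrite [LHS]rmorphXn [RHS]rmorphXn; congr (_ ^+ 2); exact: v8.
have s0 : s != 0 by rewrite -sqrf_eq0 est.
have x1n : 3 * t * (t ^+ 3 + 4) != 0.
  by apply: mulf_neq0 t4; apply: mulf_neq0 t0; apply: (Qsqrt_nat_neq0 D 2).
exists (9 * t ^+ 3 - s * (t ^+ 3 - 8)), (3 * t * (t ^+ 3 + 4)),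
  (9 * t ^+ 3 + s * (t ^+ 3 - 8)); split.
  by split; [case=> _ /eqP; rewrite (negPf x1n)|exact: cubes_AP_of_curve est].
move=> [[e01 e12]|/eqP]; last by rewrite (negPf x1n).
(* This product is [x2^3 - x0^3], which a constant progression would make zero. *)
have : 2 * (s * (t ^+ 3 - 8)) * (243 * t ^+ 6 + s ^+ 2 * (t ^+ 3 - 8) ^+ 2) == 0.
  by rewrite -(subrr ((3 * t * (t ^+ 3 + 4)) ^+ 3)) {1}e12 -e01; apply/eqP; ring.
apply/negP; rewrite est; apply: mulf_neq0 tq.
by apply: mulf_neq0 (mulf_neq0 s0 t8); apply: (Qsqrt_nat_neq0 D 1).
Qed.
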